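(* Let $G(\Delta)\in\mathcal G_3$ (triangular gain-scheduling plant class) and $\gamma>0$ be given. The following two statements are equivalent. (i) There exist a structured controller $K(\Delta)\in\mathcal K_3$ with $r^c=s^c=:l^c$, symmetric $\mathcal X_1\succ0$ and $\mathcal P\in\mathbf P$ such that the closed-loop matrices of the lifted plant with $K(\Delta)$ satisfy $$\mathcal N^T\mathrm{diag}\!\left(\begin{pmatrix}0&\mathcal X_1\\ \mathcal X_1&0\end{pmatrix},\begin{pmatrix}0&\mathcal P\\ \mathcal P&0\end{pmatrix},\begin{pmatrix}-\gamma I&0\\0&I\end{pmatrix}\right)\mathcal N\prec0,\qquad \mathcal N=\begin{pmatrix}I&0&0\\ \mathcal A_{11}&\mathcal A_{12}&\mathcal B_1\\0&I&0\\ \mathcal A_{21}&\mathcal A_{22}&\mathcal B_2\\0&0&I\\ \mathcal C_1&\mathcal C_2&\mathcal D\end{pmatrix}.\tag{1}$$ (ii) There exist Lyapunov variables $(S_3,T_1,S_{22},T_{22},W)$, multiplier variables $(P_3,Q_1,P_{\mu\nu},Q_{\mu\nu},R_{\mu\nu})$ with $P_3\in\mathbf P_p$, $Q_1\in\mathbf P_d$, and lower block triangular controller variables $\mathsf K_{ij},\mathsf L_i,\mathsf M_j,\mathsf N$ ($i,j=1,2$), all as described in the context, such that $$\mathbb N^T\mathrm{diag}\!\left(\begin{pmatrix}0&I\\ I&0\end{pmatrix},\begin{pmatrix}0&I\\ I&0\end{pmatrix},\begin{pmatrix}-\gamma I&0\\0&I\end{pmatrix}\right)\mathbb N\prec0,\qquad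 \mathbb N=\begin{pmatrix}I&0&0\\ \mathbb A_{11}&\mathbb A_{12}&\mathbb B_1\\0&I&0\\ \mathbb A_{21}&\mathbb A_{22}&\mathbb B_2\\0&0&I\\ \mathbb C_1&\mathbb C_2&\mathbb D\end{pmatrix},\qquad \mathbb X\succ0,$$ $$P_2^T\Delta_l(\Delta)Q_2+\bigl(P_2^T\Delta_l(\Delta)Q_2\bigr)^T\succ0\quad\text{for all }\Delta\in\mathbf V,$$ where, for $i,j=1,2$, $$\begin{pmatrix}\mathbb A_{ij}&\mathbb B_i\\ \mathbb C_j&\mathbb D\end{pmatrix}:=\begin{pmatrix}A_{ij}Y_j&A_{ij}&B_i^p\\0&X_i^TA_{ij}&X_i^TB_i^p\\ C_j^pY_j&C_j^p&D^p\end{pmatrix}+\begin{pmatrix}0&B_i\\ I&0\\0&E\end{pmatrix}\begin{pmatrix}K_{ij}&L_i\\ M_j&N\end{pmatrix}\begin{pmatrix}I&0&0\\0&C_j&F\end{pmatrix}$$ with $N:=\mathsf N$ and $$L_i:=\mathsf L_i+\mathscr U(B_i^e\mathsf N),\qquad M_j:=\mathsf M_j+\mathscr U(\mathsf NC_j^e),$$ $$K_{ij}:=\mathsf K_{ij}+\mathscr U(X_i^TA_{ij}Y_j)+\mathscr U(B_i^e\mathsf M_j)+\mathscr U(\mathsf L_iC_j^e)-B_i^e\mathsf NC_j^e.$$ Moreover, if the conditions in (ii) are satisfied, then there exist $\mathcal X_1\succ0$, $\mathcal P\in\mathbf P$ and $K(\Delta)\in\mathcal K_3$ with an affine, lower block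 triangular scheduling function $\hat\Delta_c(\cdot)$ such that (1) holds, where the sizes of $\hat A^c_{11}$ and $\hat A^c_{22}$ are bounded by $2|n|\times2|n|$ and $2|l|\times2|l|$, respectively.
   Context: All matrices are real. $\prec 0$/$\succ0$ mean negative/positive definite for symmetric matrices. For a tuple $a$ of nonnegative integers, $|a|$ is the sum of its entries; $a\times b$ matrices are $|a|\times|b|$ matrices with induced block partition. $\mathbf V=\mathrm{Co}\{\Delta_1,\dots,\Delta_N\}\subset\mathbb R^{r_\Delta\times s_\Delta}$ is the convex hull of finitely many matrices, with $0\in\mathbf V$. For $a,b\in\mathbb N_0^2$, an $a\times b$ matrix is lower block triangular if it has the form $\begin{pmatrix}J_{11}&0\\ J_{21}&J_{22}\end{pmatrix}$, $J_{\mu\nu}\in\mathbb R^{a_\mu\times b_\nu}$. For a $2\times2$ block matrix, $\mathscr U\begin{pmatrix}J_{11}&J_{12}\\ J_{21}&J_{22}\end{pmatrix}:=\begin{pmatrix}0&J_{12}\\0&0\end{pmatrix}$. Class $\mathcal G_3$ (plants): $$\begin{pmatrix}\dot x\\ \hat z\\ z_p\\ y\end{pmatrix}=\begin{pmatrix}\hat A_{11}&\hat A_{12}&\hat B_1^p&\hat B_1\\ \hat A_{21}&\hat A_{22}&\hat B_2^p&\hat B_2\\ \hat C_1^p&\hat C_2^p&\hat D^p&\hat E\\ \hat C_1&\hat C_2&\hat F&0\end{pmatrix}\begin{pmatrix}x\\ \hat w\\ w_p\\ u\end{pmatrix},\quad \hat w=\hat\Delta(\Delta)\hat z,\quad \hat\Delta(\Delta)=\begin{pmatrix}\Delta&0\\0&\Delta\end{pmatrix},$$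 $x,\hat w,\hat z,w_p,z_p,u,y$ of dimensions $|n|,|r|,|s|,m^p,k^p,|m|,|k|$ with partitions $n=(n_1,n_2)$, $m=(m_1,m_2)$, $k=(k_1,k_2)$, $r=(r_1,r_2)=(r_\Delta,r_\Delta)$, $s=(s_1,s_2)=(s_\Delta,s_\Delta)$; $\hat A_{ij},\hat B_i,\hat C_j$ ($i,j=1,2$) are lower block triangular in these partitions and $\hat B_i^p,\hat C_j^p,\hat D^p,\hat E,\hat F$ are unstructured. Class $\mathcal K_3$ (controllers): $$\begin{pmatrix}\dot x_c\\ \hat z_c\\ u\end{pmatrix}=\begin{pmatrix}\hat A^c_{11}&\hat A^c_{12}&\hat B^c_1\\ \hat A^c_{21}&\hat A^c_{22}&\hat B^c_2\\ \hat C^c_1&\hat C^c_2&\hat D^c\end{pmatrix}\begin{pmatrix}x_c\\ \hat w_c\\ y\end{pmatrix},\quad \hat w_c=\hat\Delta_c(\Delta)\hat z_c,$$ with $x_c,\hat w_c,\hat z_c$ partitioned by free $n^c,r^c,s^c\in\mathbb N_0^2$, all nine matrices lower block triangular (partitions $n^c,s^c,m$ for rows and $n^c,r^c,k$ for columns), and $\hat\Delta_c:\mathbf V\to\mathbb R^{r^c\times s^c}$ a function with lower block triangular values. Lifted plant, with $l:=(r,s)=(r_1,r_2,s_1,s_2)$ so $|l|=|r|+|s|$: $A_{11}=\hat A_{11}$, $A_{12}=(\hat A_{12}\ \ 0)$, $A_{21}=\begin{pmatrix}0\\2\hat A_{21}\end{pmatrix}$, $A_{22}=\begin{pmatrix}I_{|r|}&0\\2\hat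 A_{22}&-I_{|s|}\end{pmatrix}$, $B_1^p=\hat B_1^p$, $B_2^p=\begin{pmatrix}0\\2\hat B_2^p\end{pmatrix}$, $B_1=\hat B_1$, $B_2=\begin{pmatrix}0\\2\hat B_2\end{pmatrix}$, $C_1^p=\hat C_1^p$, $C_2^p=(\hat C_2^p\ \ 0)$, $C_1=\hat C_1$, $C_2=(\hat C_2\ \ 0)$, $D^p=\hat D^p$, $E=\hat E$, $F=\hat F$, $\Delta_l(\Delta)=\begin{pmatrix}-I_{|r|}&2\hat\Delta(\Delta)\\0&I_{|s|}\end{pmatrix}$. Closed loop of the lifted plant with the controller ($r^c=s^c=l^c$): for $i,j=1,2$, $$\begin{pmatrix}\mathcal A_{ij}&\mathcal B_i\\ \mathcal C_j&\mathcal D\end{pmatrix}=\begin{pmatrix}A_{ij}&0&B_i^p\\0&0&0\\ C_j^p&0&D^p\end{pmatrix}+\begin{pmatrix}0&B_i\\ I&0\\0&E\end{pmatrix}\begin{pmatrix}\hat A^c_{ij}&\hat B^c_i\\ \hat C^c_j&\hat D^c\end{pmatrix}\begin{pmatrix}0&I&0\\ C_j&0&F\end{pmatrix},$$ $\Delta_{lc}(\Delta):=\mathrm{diag}(\Delta_l(\Delta),\hat\Delta_c(\Delta))$, and $\mathbf P$ (depending on $\hat\Delta_c$) is the set of symmetric $\mathcal P$ of size $|l|+|l^c|$ with $\begin{pmatrix}\Delta_{lc}(\Delta)\\ I\end{pmatrix}^T\begin{pmatrix}0&\mathcal P\\ \mathcal P&0\end{pmatrix}\begin{pmatrix}\Delta_{lc}(\Delta)\\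 I\end{pmatrix}\succ0$ for all $\Delta\in\mathbf V$. Scaling classes: $\mathbf P_p$ is the set of symmetric $P$ of size $|l|$ with $\begin{pmatrix}I_{|r|}\\0\end{pmatrix}^TP\begin{pmatrix}I_{|r|}\\0\end{pmatrix}\prec0$ and $\begin{pmatrix}\hat\Delta(\Delta)\\ I_{|s|}\end{pmatrix}^TP\begin{pmatrix}\hat\Delta(\Delta)\\ I_{|s|}\end{pmatrix}\succ0$ for all $\Delta\in\mathbf V$; $\mathbf P_d$ is the set of symmetric $\tilde P$ of size $|l|$ with $\begin{pmatrix}0\\ I_{|s|}\end{pmatrix}^T\tilde P\begin{pmatrix}0\\ I_{|s|}\end{pmatrix}\succ0$ and $\begin{pmatrix}I_{|r|}\\-\hat\Delta(\Delta)^T\end{pmatrix}^T\tilde P\begin{pmatrix}I_{|r|}\\-\hat\Delta(\Delta)^T\end{pmatrix}\prec0$ for all $\Delta\in\mathbf V$. Partitions: $a=u:=(|n|,|n|)$, $b=v:=(|l|,|l|)$. Lyapunov variables: symmetric $S_3,T_1\in\mathbb R^{|n|\times|n|}$, symmetric $S_{22}\in\mathbb R^{n_1\times n_1}$, $T_{22}\in\mathbb R^{n_2\times n_2}$, and $W\in\mathbb R^{n_2\times n_1}$; set $$S_2:=\begin{pmatrix}S_{22}&W^T\\0&I_{n_2}\end{pmatrix},\quad T_2:=\begin{pmatrix}I_{n_1}&0\\-W&T_{22}\end{pmatrix},\quad X_1:=(S_2\ \ S_3)\in\mathbb R^{|n|\times2|n|},\quad Y_1:=(T_1\ \ T_2)\in\mathbb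 R^{|n|\times2|n|},$$ $$\mathbb X:=\begin{pmatrix}T_1&T_2&I\\ T_2^T&T_2^TS_2&S_2^T\\ I&S_2&S_3\end{pmatrix},$$ which is symmetric. Multiplier variables: $P_3\in\mathbf P_p$, $Q_1\in\mathbf P_d$, symmetric $\begin{pmatrix}P_{22}&P_{23}\\P_{32}&P_{33}\end{pmatrix}$ of partition $(r_1,s_1)$, symmetric $\begin{pmatrix}Q_{22}&Q_{23}\\Q_{32}&Q_{33}\end{pmatrix}$ of partition $(r_2,s_2)$, and $\begin{pmatrix}R_{22}&R_{23}\\R_{32}&R_{33}\end{pmatrix}$ of partition $(r_2,s_2)\times(r_1,s_1)$; set, in the partition $(r_1,r_2,s_1,s_2)$, $$P_2:=\begin{pmatrix}P_{22}&R_{22}^T&P_{23}&R_{32}^T\\0&I_{r_2}&0&0\\P_{32}&R_{23}^T&P_{33}&R_{33}^T\\0&0&0&I_{s_2}\end{pmatrix},\quad Q_2:=\begin{pmatrix}I_{r_1}&0&0&0\\-R_{22}&Q_{22}&-R_{23}&Q_{23}\\0&0&I_{s_1}&0\\-R_{32}&Q_{32}&-R_{33}&Q_{33}\end{pmatrix},$$ $$X_2:=(P_2\ \ P_3)\in\mathbb R^{|l|\times2|l|},\qquad Y_2:=(Q_1\ \ Q_2)\in\mathbb R^{|l|\times2|l|}.$$ Controller variables: lower block triangular $\mathsf K_{11},\mathsf K_{12},\mathsf K_{21},\mathsf K_{22}$ of partitions $a\times u$, $a\times v$, $b\times u$, $b\times v$; $\mathsf L_1,\mathsf L_2$ of partitions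 $a\times k$, $b\times k$; $\mathsf M_1,\mathsf M_2$ of partitions $m\times u$, $m\times v$; $\mathsf N$ of partition $m\times k$. The projection $\mathscr U$ is applied with respect to these partitions. Auxiliary matrices: let $\tilde B_i$ consist of the last $m_2$ columns of $B_i$ and $\tilde C_j$ of the first $k_1$ rows of $C_j$ (lifted plant matrices). Then $$B_i^e:=\begin{pmatrix}0&\tilde B_i\\0&0\end{pmatrix},\qquad C_j^e:=\begin{pmatrix}0&\tilde C_j\\0&0\end{pmatrix},$$ where $B_1^e,B_2^e$ have partitions $a\times m$, $b\times m$ and $C_1^e,C_2^e$ have partitions $k\times u$, $k\times v$. *)

(* Defs.v *)
From HB Require Import structures.
From mathcomp Require Import all_boot all_order all_algebra.
From mathcomp Require Import reals.

Set Implicit Arguments.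
Unset Strict Implicit.
Unset Printing Implicit Defensive.

Import Order.TTheory GRing.Theory Num.Theory.
Local Open Scope ring_scope.

(* A two-block partition (a1, a2) is carried by the dimension a1 + a2 itself, *)
(* so that the library's block operations refer to it directly.               *)

Definition posdef (R : realType) n (M : 'M[R]_n) : Prop :=
  M \is symmetricmx /\ forall x : 'cV[R]_n, x != 0 -> 0 < (x^T *m M *m x) 0 0.

Definition negdef (R : realType) n (M : 'M[R]_n) : Prop :=
  M \is symmetricmx /\ forall x : 'cV[R]_n, x != 0 -> (x^T *m M *m x) 0 0 < 0.

Definition conv_hull (R : realType) p q N (D : 'I_N -> 'M[R]_(p, q))
    (M : 'M[R]_(p, q)) : Prop :=
  exists w : 'I_N -> R,
    [/\ forall i, 0 <= w i, \sum_i w i = 1 & M = \sum_i w i *: D i].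

Definition lower_block_tri (R : realType) a1 a2 b1 b2
    (J : 'M[R]_(a1 + a2, b1 + b2)) : Prop :=
  ursubmx J = 0.

Definition upper_part (R : realType) a1 a2 b1 b2
    (J : 'M[R]_(a1 + a2, b1 + b2)) : 'M[R]_(a1 + a2, b1 + b2) :=
  block_mx 0 (ursubmx J) 0 0.

Definition anti_diag (R : realType) p (X : 'M[R]_p) : 'M[R]_(p + p) :=
  block_mx 0 X X 0.

(* The system matrices are passed as the 2 x 2 family                         *)
(*   Gij = [A_ij, B_i; C_j, D]   (i, j = 1, 2).                               *)
(* In all uses B_i does not depend on j, C_j not on i, and D on neither, so   *)
(* B_i is read off Gi i, C_j off Gj j and D off G11.                          *)
Definition outer_factor (R : realType) p q mp kp
    (G11 : 'M[R]_(p + kp, p + mp)) (G12 : 'M[R]_(p + kp, q + mp))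
    (G21 : 'M[R]_(q + kp, p + mp)) (G22 : 'M[R]_(q + kp, q + mp)) :
    'M[R]_((p + p) + (q + q) + (mp + kp), p + q + mp) :=
  let A11 := ulsubmx G11 in let A12 := ulsubmx G12 in
  let A21 := ulsubmx G21 in let A22 := ulsubmx G22 in
  let B1 := ursubmx G11 in let B2 := ursubmx G22 in
  let C1 := dlsubmx G11 in let C2 := dlsubmx G22 in
  let D := drsubmx G11 in
  col_mx
    (col_mx
       (col_mx (row_mx (row_mx 1%:M 0) 0) (row_mx (row_mx A11 A12) B1))
       (col_mx (row_mx (row_mx 0 1%:M) 0) (row_mx (row_mx A21 A22) B2)))
    (col_mx (row_mx (row_mx 0 0) 1%:M) (row_mx (row_mx C1 C2) D)).

Definition performance_form (R : realType) p q mp kp (gamma : R)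
    (X : 'M[R]_p) (P : 'M[R]_q)
    (G11 : 'M[R]_(p + kp, p + mp)) (G12 : 'M[R]_(p + kp, q + mp))
    (G21 : 'M[R]_(q + kp, p + mp)) (G22 : 'M[R]_(q + kp, q + mp)) :
    'M[R]_(p + q + mp) :=
  let N := outer_factor G11 G12 G21 G22 in
  N^T *m block_mx (block_mx (anti_diag X) 0 0 (anti_diag P)) 0 0
                  (block_mx (- gamma%:M) 0 0 1%:M) *m N.

(* State, scheduling output and scheduling input have the dimensions n1 + n2, *)
(* sD + sD and rD + rD.  The prefix h stands for the hats of the plant data,  *)
(* and the prefix l below for the lifted plant.                               *)
Record plant (R : realType) (n1 n2 m1 m2 k1 k2 rD sD mp kp : nat) := Plant {
  hA11 : 'M[R]_(n1 + n2, n1 + n2);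
  hA12 : 'M[R]_(n1 + n2, rD + rD);
  hA21 : 'M[R]_(sD + sD, n1 + n2);
  hA22 : 'M[R]_(sD + sD, rD + rD);
  hB1p : 'M[R]_(n1 + n2, mp);
  hB2p : 'M[R]_(sD + sD, mp);
  hB1 : 'M[R]_(n1 + n2, m1 + m2);
  hB2 : 'M[R]_(sD + sD, m1 + m2);
  hC1p : 'M[R]_(kp, n1 + n2);
  hC2p : 'M[R]_(kp, rD + rD);
  hC1 : 'M[R]_(k1 + k2, n1 + n2);
  hC2 : 'M[R]_(k1 + k2, rD + rD);
  hDp : 'M[R]_(kp, mp);
  hE : 'M[R]_(kp, m1 + m2);
  hF : 'M[R]_(k1 + k2, mp);
  hA11_tri : lower_block_tri hA11; hA12_tri : lower_block_tri hA12;
  hA21_tri : lower_block_tri hA21; hA22_tri : lower_block_tri hA22;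
  hB1_tri : lower_block_tri hB1; hB2_tri : lower_block_tri hB2;
  hC1_tri : lower_block_tri hC1; hC2_tri : lower_block_tri hC2
}.

(* Only the values of the scheduling function csched on the set V of          *)
(* admissible parameters are meaningful.                                      *)
Record controller (R : realType) (m1 m2 k1 k2 rD sD : nat)
    (V : 'M[R]_(rD, sD) -> Prop) (nc1 nc2 rc1 rc2 sc1 sc2 : nat) := Controller {
  cA11 : 'M[R]_(nc1 + nc2, nc1 + nc2);
  cA12 : 'M[R]_(nc1 + nc2, rc1 + rc2);
  cA21 : 'M[R]_(sc1 + sc2, nc1 + nc2);
  cA22 : 'M[R]_(sc1 + sc2, rc1 + rc2);
  cB1 : 'M[R]_(nc1 + nc2, k1 + k2);
  cB2 : 'M[R]_(sc1 + sc2, k1 + k2);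
  cC1 : 'M[R]_(m1 + m2, nc1 + nc2);
  cC2 : 'M[R]_(m1 + m2, rc1 + rc2);
  cD : 'M[R]_(m1 + m2, k1 + k2);
  csched : 'M[R]_(rD, sD) -> 'M[R]_(rc1 + rc2, sc1 + sc2);
  cA11_tri : lower_block_tri cA11; cA12_tri : lower_block_tri cA12;
  cA21_tri : lower_block_tri cA21; cA22_tri : lower_block_tri cA22;
  cB1_tri : lower_block_tri cB1; cB2_tri : lower_block_tri cB2;
  cC1_tri : lower_block_tri cC1; cC2_tri : lower_block_tri cC2;
  cD_tri : lower_block_tri cD;
  csched_tri : forall Delta, V Delta -> lower_block_tri (csched Delta)
}.

Definition affine_on (R : realType) p q a b (V : 'M[R]_(p, q) -> Prop)
    (f : 'M[R]_(p, q) -> 'M[R]_(a, b)) : Prop :=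
  exists (f0 : 'M[R]_(a, b)) (L : {linear 'M[R]_(p, q) -> 'M[R]_(a, b)}),
    forall Delta, V Delta -> f Delta = f0 + L Delta.

Definition hat_Delta (R : realType) rD sD (Delta : 'M[R]_(rD, sD)) :
    'M[R]_(rD + rD, sD + sD) :=
  block_mx Delta 0 0 Delta.

Definition Delta_l (R : realType) rD sD (Delta : 'M[R]_(rD, sD)) :
    'M[R]_((rD + rD) + (sD + sD)) :=
  block_mx (- 1%:M) (2%:R *: hat_Delta Delta) 0 1%:M.

Section LiftedPlant.
Variables (R : realType) (n1 n2 m1 m2 k1 k2 rD sD mp kp : nat).
Variable G : plant R n1 n2 m1 m2 k1 k2 rD sD mp kp.

Local Notation n := (n1 + n2)%N.
Local Notation m := (m1 + m2)%N.
Local Notation k := (k1 + k2)%N.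
Local Notation l := ((rD + rD) + (sD + sD))%N.

Definition lA11 : 'M[R]_(n, n) := hA11 G.
Definition lA12 : 'M[R]_(n, l) := row_mx (hA12 G) 0.
Definition lA21 : 'M[R]_(l, n) := col_mx 0 (2%:R *: hA21 G).
Definition lA22 : 'M[R]_(l, l) := block_mx 1%:M 0 (2%:R *: hA22 G) (- 1%:M).
Definition lB1p : 'M[R]_(n, mp) := hB1p G.
Definition lB2p : 'M[R]_(l, mp) := col_mx 0 (2%:R *: hB2p G).
Definition lB1 : 'M[R]_(n, m) := hB1 G.
Definition lB2 : 'M[R]_(l, m) := col_mx 0 (2%:R *: hB2 G).
Definition lC1p : 'M[R]_(kp, n) := hC1p G.
Definition lC2p : 'M[R]_(kp, l) := row_mx (hC2p G) 0.
Definition lC1 : 'M[R]_(k, n) := hC1 G.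
Definition lC2 : 'M[R]_(k, l) := row_mx (hC2 G) 0.
Definition lDp : 'M[R]_(kp, mp) := hDp G.
Definition lE : 'M[R]_(kp, m) := hE G.
Definition lF : 'M[R]_(k, mp) := hF G.

End LiftedPlant.

(* The block [A_ij, B_i; C_j, D] of the closed loop, from the (i, j) data of  *)
(* the lifted plant and of the controller.                                    *)
Definition closed_loop_block (R : realType) di dj ci cj m k mp kp
    (A : 'M[R]_(di, dj)) (Bp : 'M[R]_(di, mp)) (B : 'M[R]_(di, m))
    (Cp : 'M[R]_(kp, dj)) (C : 'M[R]_(k, dj))
    (Dp : 'M[R]_(kp, mp)) (E : 'M[R]_(kp, m)) (F : 'M[R]_(k, mp))
    (Ac : 'M[R]_(ci, cj)) (Bc : 'M[R]_(ci, k))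
    (Cc : 'M[R]_(m, cj)) (Dc : 'M[R]_(m, k)) :
    'M[R]_((di + ci) + kp, (dj + cj) + mp) :=
  block_mx (block_mx A 0 0 0) (col_mx Bp 0) (row_mx Cp 0) Dp
  + col_mx (block_mx 0 B 1%:M 0) (row_mx 0 E)
    *m block_mx Ac Bc Cc Dc
    *m block_mx (row_mx 0 1%:M) 0 (row_mx C 0) F.

Section Analysis.
Variables (R : realType) (n1 n2 m1 m2 k1 k2 rD sD mp kp : nat).
Variable V : 'M[R]_(rD, sD) -> Prop.
Variable gamma : R.
Variable G : plant R n1 n2 m1 m2 k1 k2 rD sD mp kp.
Variables nc1 nc2 lc1 lc2 : nat.
Variable K : controller m1 m2 k1 k2 V nc1 nc2 lc1 lc2 lc1 lc2.

Local Notation n := (n1 + n2)%N.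
Local Notation nc := (nc1 + nc2)%N.
Local Notation l := ((rD + rD) + (sD + sD))%N.
Local Notation lc := (lc1 + lc2)%N.

Definition Delta_lc (Delta : 'M[R]_(rD, sD)) : 'M[R]_(l + lc) :=
  block_mx (Delta_l Delta) 0 0 (csched K Delta).

Definition full_multiplier (P : 'M[R]_(l + lc)) : Prop :=
  P \is symmetricmx /\
  forall Delta, V Delta ->
    let O := col_mx (Delta_lc Delta) 1%:M in
    posdef (O^T *m anti_diag P *m O).

Definition cl11 : 'M[R]_((n + nc) + kp, (n + nc) + mp) :=
  closed_loop_block (lA11 G) (lB1p G) (lB1 G) (lC1p G) (lC1 G)
    (lDp G) (lE G) (lF G) (cA11 K) (cB1 K) (cC1 K) (cD K).
Definition cl12 : 'M[R]_((n + nc) + kp, (l + lc) + mp) :=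
  closed_loop_block (lA12 G) (lB1p G) (lB1 G) (lC2p G) (lC2 G)
    (lDp G) (lE G) (lF G) (cA12 K) (cB1 K) (cC2 K) (cD K).
Definition cl21 : 'M[R]_((l + lc) + kp, (n + nc) + mp) :=
  closed_loop_block (lA21 G) (lB2p G) (lB2 G) (lC1p G) (lC1 G)
    (lDp G) (lE G) (lF G) (cA21 K) (cB2 K) (cC1 K) (cD K).
Definition cl22 : 'M[R]_((l + lc) + kp, (l + lc) + mp) :=
  closed_loop_block (lA22 G) (lB2p G) (lB2 G) (lC2p G) (lC2 G)
    (lDp G) (lE G) (lF G) (cA22 K) (cB2 K) (cC2 K) (cD K).

Definition analysis_lmi (X1 : 'M[R]_(n + nc)) (P : 'M[R]_(l + lc)) : Prop :=
  negdef (performance_form gamma X1 P cl11 cl12 cl21 cl22).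

End Analysis.

Section Scalings.
Variables (R : realType) (rD sD : nat) (V : 'M[R]_(rD, sD) -> Prop).

Local Notation r := (rD + rD)%N.
Local Notation s := (sD + sD)%N.
Local Notation l := (r + s)%N.

Definition primal_scaling (P : 'M[R]_l) : Prop :=
  [/\ P \is symmetricmx,
      let O := col_mx 1%:M 0 : 'M[R]_(l, r) in negdef (O^T *m P *m O)
    & forall Delta, V Delta ->
        let O := col_mx (hat_Delta Delta) 1%:M : 'M[R]_(l, s) in
        posdef (O^T *m P *m O)].

Definition dual_scaling (P : 'M[R]_l) : Prop :=
  [/\ P \is symmetricmx,
      let O := col_mx 0 1%:M : 'M[R]_(l, s) in posdef (O^T *m P *m O)
    & forall Delta, V Delta ->
        let O := col_mx 1%:M (- (hat_Delta Delta)^T) : 'M[R]_(l, r) in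
        negdef (O^T *m P *m O)].

End Scalings.

Record lyapunov_vars (R : realType) (n1 n2 : nat) := LyapunovVars {
  S3 : 'M[R]_(n1 + n2);
  T1 : 'M[R]_(n1 + n2);
  S22 : 'M[R]_n1;
  T22 : 'M[R]_n2;
  W : 'M[R]_(n2, n1);
  S3_sym : S3 \is symmetricmx; T1_sym : T1 \is symmetricmx;
  S22_sym : S22 \is symmetricmx; T22_sym : T22 \is symmetricmx
}.

(* Pm, Qm and Rm are the matrices (P_ij), (Q_ij) and (R_ij), i, j = 2, 3, of  *)
(* partitions (rD, sD), with rD = r_1 = r_2 and sD = s_1 = s_2.               *)
Record multiplier_vars (R : realType) (rD sD : nat)
    (V : 'M[R]_(rD, sD) -> Prop) := MultiplierVars {
  P3 : 'M[R]_((rD + rD) + (sD + sD));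
  Q1 : 'M[R]_((rD + rD) + (sD + sD));
  Pm : 'M[R]_(rD + sD);
  Qm : 'M[R]_(rD + sD);
  Rm : 'M[R]_(rD + sD, rD + sD);
  P3_scaling : primal_scaling V P3; Q1_scaling : dual_scaling V Q1;
  Pm_sym : Pm \is symmetricmx; Qm_sym : Qm \is symmetricmx
}.

(* Below, a = u = (n, n) and b = v = (l, l).                                  *)
Record controller_vars (R : realType) (n l m1 m2 k1 k2 : nat) :=
  ControllerVars {
  sK11 : 'M[R]_(n + n, n + n);
  sK12 : 'M[R]_(n + n, l + l);
  sK21 : 'M[R]_(l + l, n + n);
  sK22 : 'M[R]_(l + l, l + l);
  sL1 : 'M[R]_(n + n, k1 + k2);
  sL2 : 'M[R]_(l + l, k1 + k2);
  sM1 : 'M[R]_(m1 + m2, n + n);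
  sM2 : 'M[R]_(m1 + m2, l + l);
  sN : 'M[R]_(m1 + m2, k1 + k2);
  sK11_tri : lower_block_tri sK11; sK12_tri : lower_block_tri sK12;
  sK21_tri : lower_block_tri sK21; sK22_tri : lower_block_tri sK22;
  sL1_tri : lower_block_tri sL1; sL2_tri : lower_block_tri sL2;
  sM1_tri : lower_block_tri sM1; sM2_tri : lower_block_tri sM2;
  sN_tri : lower_block_tri sN
}.

Section LyapunovMatrices.
Variables (R : realType) (n1 n2 : nat) (Y : lyapunov_vars R n1 n2).
Local Notation n := (n1 + n2)%N.

Definition S2 : 'M[R]_n := block_mx (S22 Y) (W Y)^T 0 1%:M.
Definition T2 : 'M[R]_n := block_mx 1%:M 0 (- W Y) (T22 Y).
Definition X1 : 'M[R]_(n, n + n) := row_mx S2 (S3 Y).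
Definition Y1 : 'M[R]_(n, n + n) := row_mx (T1 Y) T2.
Definition bbX : 'M[R]_(n + n + n) :=
  block_mx (block_mx (T1 Y) T2 T2^T (T2^T *m S2)) (col_mx 1%:M S2^T)
           (row_mx 1%:M S2) (S3 Y).

End LyapunovMatrices.

Section MultiplierMatrices.
Variables (R : realType) (rD sD : nat) (V : 'M[R]_(rD, sD) -> Prop).
Variable Z : multiplier_vars V.
Local Notation l := ((rD + rD) + (sD + sD))%N.

Let P22 := ulsubmx (Pm Z). Let P23 := ursubmx (Pm Z).
Let P32 := dlsubmx (Pm Z). Let P33 := drsubmx (Pm Z).
Let Q22 := ulsubmx (Qm Z). Let Q23 := ursubmx (Qm Z).
Let Q32 := dlsubmx (Qm Z). Let Q33 := drsubmx (Qm Z).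
Let R22 := ulsubmx (Rm Z). Let R23 := ursubmx (Rm Z).
Let R32 := dlsubmx (Rm Z). Let R33 := drsubmx (Rm Z).

Definition P2 : 'M[R]_l :=
  block_mx (block_mx P22 R22^T 0 1%:M) (block_mx P23 R32^T 0 0)
           (block_mx P32 R23^T 0 0) (block_mx P33 R33^T 0 1%:M).
Definition Q2 : 'M[R]_l :=
  block_mx (block_mx 1%:M 0 (- R22) Q22) (block_mx 0 0 (- R23) Q23)
           (block_mx 0 0 (- R32) Q32) (block_mx 1%:M 0 (- R33) Q33).
Definition X2 : 'M[R]_(l, l + l) := row_mx P2 (P3 Z).
Definition Y2 : 'M[R]_(l, l + l) := row_mx (Q1 Z) Q2.

Definition coupling_lmi : Prop :=
  forall Delta, V Delta ->
    let H := P2^T *m Delta_l Delta *m Q2 in posdef (H + H^T).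

End MultiplierMatrices.

Definition ext_B (R : realType) d m1 m2 (B : 'M[R]_(d, m1 + m2)) :
    'M[R]_(d + d, m1 + m2) :=
  block_mx 0 (rsubmx B) 0 0.

Definition ext_C (R : realType) d k1 k2 (C : 'M[R]_(k1 + k2, d)) :
    'M[R]_(k1 + k2, d + d) :=
  block_mx 0 (usubmx C) 0 0.

Definition L_of (R : realType) di m1 m2 k1 k2 (B : 'M[R]_(di, m1 + m2))
    (sL : 'M[R]_(di + di, k1 + k2)) (sN : 'M[R]_(m1 + m2, k1 + k2)) :
    'M[R]_(di + di, k1 + k2) :=
  sL + upper_part (ext_B B *m sN).

Definition M_of (R : realType) dj m1 m2 k1 k2 (C : 'M[R]_(k1 + k2, dj))
    (sM : 'M[R]_(m1 + m2, dj + dj)) (sN : 'M[R]_(m1 + m2, k1 + k2)) :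
    'M[R]_(m1 + m2, dj + dj) :=
  sM + upper_part (sN *m ext_C C).

Definition K_of (R : realType) di dj m1 m2 k1 k2
    (A : 'M[R]_(di, dj)) (B : 'M[R]_(di, m1 + m2)) (C : 'M[R]_(k1 + k2, dj))
    (X : 'M[R]_(di, di + di)) (Y : 'M[R]_(dj, dj + dj))
    (sK : 'M[R]_(di + di, dj + dj)) (sL : 'M[R]_(di + di, k1 + k2))
    (sM : 'M[R]_(m1 + m2, dj + dj)) (sN : 'M[R]_(m1 + m2, k1 + k2)) :
    'M[R]_(di + di, dj + dj) :=
  sK + upper_part (X^T *m A *m Y) + upper_part (ext_B B *m sM)
     + upper_part (sL *m ext_C C) - ext_B B *m sN *m ext_C C.

(* The block [A_ij, B_i; C_j, D] of the synthesis inequality.  Its rows are   *)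
(* naturally partitioned as (di, 2 di, kp) and its columns as (2 dj, dj, mp); *)
(* the cast only reassociates the row dimension di + (di + di), so that the   *)
(* A_ii become square.                                                        *)
Definition synthesis_block (R : realType) di dj m1 m2 k1 k2 mp kp
    (A : 'M[R]_(di, dj)) (Bp : 'M[R]_(di, mp)) (B : 'M[R]_(di, m1 + m2))
    (Cp : 'M[R]_(kp, dj)) (C : 'M[R]_(k1 + k2, dj))
    (Dp : 'M[R]_(kp, mp)) (E : 'M[R]_(kp, m1 + m2)) (F : 'M[R]_(k1 + k2, mp))
    (X : 'M[R]_(di, di + di)) (Y : 'M[R]_(dj, dj + dj))
    (sK : 'M[R]_(di + di, dj + dj)) (sL : 'M[R]_(di + di, k1 + k2))
    (sM : 'M[R]_(m1 + m2, dj + dj)) (sN : 'M[R]_(m1 + m2, k1 + k2)) :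
    'M[R]_((di + di + di) + kp, (dj + dj + dj) + mp) :=
  castmx (congr1 (addn^~ kp) (addnA di di di), erefl)
    (block_mx (block_mx (A *m Y) A 0 (X^T *m A)) (col_mx Bp (X^T *m Bp))
              (row_mx (Cp *m Y) Cp) Dp
     + col_mx (block_mx 0 B 1%:M 0) (row_mx 0 E)
       *m block_mx (K_of A B C X Y sK sL sM sN) (L_of B sL sN)
                   (M_of C sM sN) sN
       *m block_mx (row_mx 1%:M 0) 0 (row_mx 0 C) F).

Section Synthesis.
Variables (R : realType) (n1 n2 m1 m2 k1 k2 rD sD mp kp : nat).
Variable V : 'M[R]_(rD, sD) -> Prop.
Variable gamma : R.
Variable G : plant R n1 n2 m1 m2 k1 k2 rD sD mp kp.

Local Notation n := (n1 + n2)%N.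
Local Notation l := ((rD + rD) + (sD + sD))%N.

Variable Y : lyapunov_vars R n1 n2.
Variable Z : multiplier_vars V.
Variable U : controller_vars R n l m1 m2 k1 k2.

Definition syn11 : 'M[R]_((n + n + n) + kp, (n + n + n) + mp) :=
  synthesis_block (lA11 G) (lB1p G) (lB1 G) (lC1p G) (lC1 G)
    (lDp G) (lE G) (lF G) (X1 Y) (Y1 Y) (sK11 U) (sL1 U) (sM1 U) (sN U).
Definition syn12 : 'M[R]_((n + n + n) + kp, (l + l + l) + mp) :=
  synthesis_block (lA12 G) (lB1p G) (lB1 G) (lC2p G) (lC2 G)
    (lDp G) (lE G) (lF G) (X1 Y) (Y2 Z) (sK12 U) (sL1 U) (sM2 U) (sN U).
Definition syn21 : 'M[R]_((l + l + l) + kp, (n + n + n) + mp) :=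
  synthesis_block (lA21 G) (lB2p G) (lB2 G) (lC1p G) (lC1 G)
    (lDp G) (lE G) (lF G) (X2 Z) (Y1 Y) (sK21 U) (sL2 U) (sM1 U) (sN U).
Definition syn22 : 'M[R]_((l + l + l) + kp, (l + l + l) + mp) :=
  synthesis_block (lA22 G) (lB2p G) (lB2 G) (lC2p G) (lC2 G)
    (lDp G) (lE G) (lF G) (X2 Z) (Y2 Z) (sK22 U) (sL2 U) (sM2 U) (sN U).

Definition synthesis_lmi : Prop :=
  negdef (performance_form gamma 1%:M 1%:M syn11 syn12 syn21 syn22).

End Synthesis.

(* Main.v *)
Require Import Defs.
From HB Require Import structures.
From mathcomp Require Import all_boot all_order all_algebra.
From mathcomp Require Import ring lra.
From mathcomp Require Import reals.


(* The lifting turns the scaling conditions into Lyapunov-type inequalities:  *)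
(* [Delta_l] acts as -1 on [I; 0] and as +1 on [Delta; I], so that [P] is a   *)
(* primal scaling iff [P Delta_l + Delta_l^T P > 0], and dually for [Q].      *)
(* State and multiplier channels can then be treated alike.  With             *)
(*   calY = [T1 T2 I; V 0],  calZ = [I S2 S3; 0 U],                           *)
(* [V] lower and [U] upper block triangular, the relation [Xi calY = calZ]    *)
(* makes the synthesis inequality the congruence of the analysis inequality   *)
(* by [calY], and the products of [U^T], [V] with the controller matrices     *)
(* stay lower block triangular.  The corner [upper_part K] is forced, since   *)
(* [S2^T] fixes the last columns of [B] and [T2] the first rows of [C].       *)
(* Given the synthesis variables one takes [V = I]; the scheduling function   *)
(* is chosen so that it cancels all off-diagonal blocks of the transformed    *)
(* scaling inequality.  Conversely, the first column of [calY] comes from     *)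
(* [Xi^-1], and the middle one from the Schur complement [H] of the last      *)
(* block of [Xi], with [S2 = H T2].                                           *)

Set Implicit Arguments.
Unset Strict Implicit.
Unset Printing Implicit Defensive.

Import Order.TTheory GRing.Theory Num.Theory.
Local Open Scope ring_scope.

(** * Quadratic forms *)

(** The synthesis inequality is the analysis inequality in other coordinates. Evaluated at a vector,
    both forms are a sum of inner products over the state and the scheduling channel, minus [gamma]
    times |w|^2, plus |z|^2 ([closed_loop_quad], [synthesis_quad]). The values agree at
    corresponding vectors once [K_of], [L_of], [M_of] are the controller matrices transformed by [U]
    and [V] ([synthesis_closed_loop_quad]). Comparing upper right blocks shows that the transformed
    controller is triangular when the free variables are, and conversely ([ursubmx_L], [ursubmx_M],
    [ursubmx_K]). It remains to pass between [Xi] and the pair [X], [Y] in each channel.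

    From synthesis to analysis, [V = I] and symmetry determine [U] and [Xi] ([completion_mx]). In
    the state channel positivity of the coupling matrix makes [Xi] positive and [U] invertible; in
    the scheduling channel invertibility of [U] is arranged by a small rescaling
    ([multiplier_generic]). The scheduling function decouples the scaling inequality into the dual,
    the coupling and the primal condition ([sched_inner_quad]), and it is affine because [Delta_l]
    is.

    From analysis to synthesis, [calY] is built from three block columns whose images under [Xi]
    have the required zeros ([extract_congruence]). Triangularity of the scheduling function makes
    the middle column see [Delta_l] only ([multiplier_H]), and [triangular_factorization] turns the
    resulting [H] into variables of the prescribed shape. The controller sizes being arbitrary,
    [calY] may have a kernel, on which strictness is lost; [damping] and a shift of [S3] and [T1]
    recover it. *)

Definition dot (R : realType) n (u v : 'cV[R]_n) : R := (u^T *m v) 0 0.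

Section Dot.
Variable R : realType.
Implicit Types n p : nat.

Lemma dotE n (u v : 'cV[R]_n) : dot u v = \sum_i u i 0 * v i 0.
Proof. by rewrite /dot mxE; apply: eq_bigr => i _; rewrite mxE. Qed.

Lemma dotC n (u v : 'cV[R]_n) : dot u v = dot v u.
Proof. by rewrite !dotE; apply: eq_bigr => i _; rewrite mulrC. Qed.

Lemma dotDr n (u v w : 'cV[R]_n) : dot u (v + w) = dot u v + dot u w.
Proof. by rewrite /dot mulmxDr mxE. Qed.

Lemma dotDl n (u v w : 'cV[R]_n) : dot (u + v) w = dot u w + dot v w.
Proof. by rewrite dotC dotDr !(dotC w). Qed.

Lemma dotNr n (u v : 'cV[R]_n) : dot u (- v) = - dot u v.
Proof. by rewrite /dot mulmxN mxE. Qed.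

Lemma dotNl n (u v : 'cV[R]_n) : dot (- u) v = - dot u v.
Proof. by rewrite dotC dotNr dotC. Qed.

Lemma dotZr n a (u v : 'cV[R]_n) : dot u (a *: v) = a * dot u v.
Proof. by rewrite /dot -scalemxAr mxE. Qed.

Lemma dotZl n a (u v : 'cV[R]_n) : dot (a *: u) v = a * dot u v.
Proof. by rewrite dotC dotZr dotC. Qed.

Lemma dot0r n (u : 'cV[R]_n) : dot u 0 = 0.
Proof. by rewrite /dot mulmx0 mxE. Qed.

Lemma dot0l n (u : 'cV[R]_n) : dot 0 u = 0.
Proof. by rewrite dotC dot0r. Qed.

Lemma dot_mull n p (A : 'M[R]_(p, n)) (u : 'cV[R]_n) (v : 'cV[R]_p) :
  dot (A *m u) v = dot u (A^T *m v).
Proof. by rewrite /dot trmx_mul mulmxA. Qed.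

Lemma dot_col n p (u v : 'cV[R]_n) (x y : 'cV[R]_p) :
  dot (col_mx u x) (col_mx v y) = dot u v + dot x y.
Proof. by rewrite /dot tr_col_mx mul_row_col mxE. Qed.

Lemma dot_ge0 n (u : 'cV[R]_n) : 0 <= dot u u.
Proof. by rewrite dotE; apply: sumr_ge0 => i _; rewrite -expr2 sqr_ge0. Qed.

Lemma dot_eq0 n (u : 'cV[R]_n) : (dot u u == 0) = (u == 0).
Proof.
apply/idP/eqP => [|->]; last by rewrite dot0r.
rewrite dotE psumr_eq0 => [/allP u0|i _]; last by rewrite -expr2 sqr_ge0.
apply/colP => i; rewrite mxE; apply/eqP.
by have /= := u0 i (mem_index_enum i); rewrite mulf_eq0 orbb.
Qed.

Lemma dot_gt0 n (u : 'cV[R]_n) : (0 < dot u u) = (u != 0).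
Proof. by rewrite lt_def dot_eq0 dot_ge0 andbT. Qed.

Lemma symmetricP n (M : 'M[R]_n) : reflect (M^T = M) (M \is symmetricmx).
Proof.
rewrite qualifE /= expr0 scale1r map_mx_id //.
by apply: (iffP eqP) => /esym.
Qed.

Lemma quadE n (M : 'M[R]_n) (x : 'cV[R]_n) :
  (x^T *m M *m x) 0 0 = dot x (M *m x).
Proof. by rewrite /dot mulmxA. Qed.

Lemma posdefP n (M : 'M[R]_n) :
  posdef M <-> M^T = M /\ forall x, x != 0 -> 0 < dot x (M *m x).
Proof.
rewrite /posdef; split=> -[/symmetricP Ms Mx]; split=> // x /Mx;
by rewrite quadE.
Qed.

Lemma negdefP n (M : 'M[R]_n) :
  negdef M <-> M^T = M /\ forall x, x != 0 -> dot x (M *m x) < 0.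
Proof.
rewrite /negdef; split=> -[/symmetricP Ms Mx]; split=> // x /Mx;
by rewrite quadE.
Qed.

Lemma negdefN n (M : 'M[R]_n) : negdef M <-> posdef (- M).
Proof.
rewrite negdefP posdefP; split=> -[Ms Mx]; split.
- by rewrite linearN /= Ms.
- by move=> x /Mx; rewrite mulNmx dotNr oppr_gt0.
- by apply: oppr_inj; rewrite -Ms linearN.
- by move=> x /Mx; rewrite mulNmx dotNr oppr_gt0.
Qed.

Lemma unitmx_inj n (M : 'M[R]_n) :
  (forall x : 'cV[R]_n, M *m x = 0 -> x = 0) -> M \in unitmx.
Proof.
move=> Minj; rewrite -unitmx_tr -row_free_unit -kermx_eq0; apply/eqP/row_matrixP => i.
rewrite row0; apply: trmx_inj; rewrite trmx0; apply: Minj.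
apply: trmx_inj; rewrite trmx_mul trmxK -row_mul mulmx_ker row0.
by rewrite trmx0.
Qed.

Lemma quad_bounded n (M : 'M[R]_n) :
  exists2 C, 0 <= C & forall x, `|dot x (M *m x)| <= C * dot x x.
Proof.
exists (\sum_i \sum_j `|M i j|).
  by apply: sumr_ge0 => i _; apply: sumr_ge0.
move=> x; rewrite {1}dotE mulr_suml; apply: le_trans (ler_norm_sum _ _ _) _.
apply: ler_sum => i _; rewrite mxE mulr_sumr mulr_suml.
apply: le_trans (ler_norm_sum _ _ _) _; apply: ler_sum => j _.
rewrite mulrCA normrM; apply: ler_wpM2l => //.
have le_dot k : x k 0 ^+ 2 <= dot x x.
  rewrite dotE (bigD1 k) //= -expr2 lerDl; apply: sumr_ge0 => a _.
  by rewrite -expr2 sqr_ge0.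
rewrite ler_norml; have := le_dot i; have := le_dot j.
have := sqr_ge0 (x i 0 + x j 0); have := sqr_ge0 (x i 0 - x j 0).
rewrite !expr2 => *; apply/andP; split; nra.
Qed.

Lemma dot_parallelogram n (u v : 'cV[R]_n) :
  dot (u + v) (u + v) <= 2 * (dot u u + dot v v).
Proof.
have := dot_ge0 (u - v).
rewrite !dotDl !dotDr !dotNl !dotNr (dotC v u); lra.
Qed.

(* Induction on the size: with [e] the first basis vector, the map [J]         *)
(* embeds the remaining coordinates [M]-orthogonally to [e].                   *)
Lemma posdef_coercive n (M : 'M[R]_n) : posdef M ->
  exists2 C, 0 <= C & forall x, dot x x <= C * dot x (M *m x).
Proof.
elim: n M => [|n IHn] M /posdefP [Ms Mx].
  by exists 1 => // x; rewrite !dotE !big_ord0 mulr0.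
rewrite -[n.+1]/(1 + n)%N in M Ms Mx *.
pose e : 'cV[R]_(1 + n) := col_mx 1%:M 0; pose m := dot e (M *m e).
have m_gt0 : 0 < m.
  apply: Mx; rewrite col_mx_eq0 negb_and; apply/orP; left.
  by apply/eqP => /matrixP /(_ 0 0); rewrite !mxE => /eqP; rewrite oner_eq0.
pose E : 'M[R]_(1 + n, n) := col_mx 0 1%:M.
pose J := E - m^-1 *: (e *m (e^T *m M *m E)).
have JE y : J *m y = E *m y - (m^-1 * dot e (M *m (E *m y))) *: e.
  rewrite mulmxBl -scalemxAl -[e *m _ *m y]mulmxA /dot -scalerA.
  by congr (_ - _ *: _); rewrite -mul_mx_scalar -mx11_scalar !mulmxA.
have orthJ y : dot e (M *m (J *m y)) = 0.
  by rewrite JE mulmxBr -scalemxAr dotDr dotNr dotZr mulrAC mulVf ?gt_eqF // mul1r subrr.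
have J_inj (y : 'cV_n) : J *m y = 0 -> y = 0.
  rewrite JE mul_col_mx mul0mx mul1mx scale_col_mx opp_col_mx add_col_mx.
  by move/eqP; rewrite col_mx_eq0 scaler0 subr0 => /andP [_ /eqP].
have [C C0 HC] : exists2 C, 0 <= C &
    forall y, dot y y <= C * dot (J *m y) (M *m (J *m y)).
  have [|C C0 HC] := IHn (J^T *m M *m J); last first.
    by exists C => // y; have := HC y; rewrite -!mulmxA -dot_mull.
  apply/posdefP; split=> [|y /eqP yN0].
    by rewrite !trmx_mul trmxK Ms mulmxA.
  rewrite -!mulmxA -dot_mull; apply: Mx; apply/eqP => /J_inj; exact: yN0.
have [C' C'0 HC'] := quad_bounded (J^T *m J).
have CC0 : 0 <= C' * C by apply: mulr_ge0.
(* For x = s e + J y the form splits as s^2 m plus the form at J y. The 2 comes from the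
   parallelogram bound on |x|^2; [m^-1 * dot e e] handles the e-part and [C' * C] bounds |J y|^2. *)
exists (2 * (m^-1 * dot e e + C' * C)) => [|x].
  by rewrite mulr_ge0 // addr_ge0 // mulr_ge0 ?dot_ge0 // invr_ge0 ltW.
have [s [y ->]] : exists s y, x = s *: e + J *m y.
  exists (usubmx x 0 0 + m^-1 * dot e (M *m (E *m dsubmx x))); exists (dsubmx x).
  rewrite JE scalerDl addrACA subrr addr0.
  rewrite mul_col_mx mul0mx mul1mx scale_col_mx scaler0 add_col_mx addr0 add0r.
  by rewrite -[LHS]vsubmxK scalemx1 -mx11_scalar.
have -> : dot (s *: e + J *m y) (M *m (s *: e + J *m y)) =
    s ^+ 2 * m + dot (J *m y) (M *m (J *m y)).
  rewrite mulmxDr -scalemxAr !dotDl !dotDr !dotZl !dotZr orthJ.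
  have -> : dot (J *m y) (M *m e) = 0 by rewrite dotC dot_mull Ms orthJ.
  by rewrite /m; ring.
apply: le_trans (dot_parallelogram _ _) _.
rewrite -mulrA ler_pM2l // mulrDl !dotZl !dotZr.
have := HC y; have := HC' y; rewrite -!mulmxA -dot_mull.
have mm : m^-1 * m = 1 by rewrite mulVf ?gt_eqF.
have q0 : 0 <= dot (J *m y) (M *m (J *m y)).
  by have [->|/Mx/ltW//] := eqVneq (J *m y) 0; rewrite dot0l.
move: q0 (dot_ge0 e); set q := dot _ (M *m _) => q0 e0.
rewrite ler_norml => /andP [_ dz] zq.
have -> : m^-1 * dot e e * (s ^+ 2 * m + q) = s * (s * dot e e) + m^-1 * dot e e * q.
  by rewrite mulrDr; congr (_ + _); rewrite -[RHS]mul1r -mm; ring.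
have le1 : dot (J *m y) (J *m y) <= C' * C * q.
  by apply: le_trans dz _; rewrite -mulrA ler_wpM2l.
have le2 : 0 <= C' * C * (s ^+ 2 * m) by rewrite mulr_ge0 // mulr_ge0 ?sqr_ge0 ?(ltW m_gt0).
have le3 : 0 <= m^-1 * dot e e * q by rewrite mulr_ge0 // mulr_ge0 // invr_ge0 ltW.
rewrite mulrDr; lra.
Qed.

(** Coercivity leaves a margin proportional to |x|^2, which absorbs the terms linear and quadratic
    in [s]. *)
Lemma negdef_open n p (Q : 'M[R]_p) (N0 N1 : 'M[R]_(p, n)) :
  Q^T = Q -> negdef (N0^T *m Q *m N0) ->
  exists2 eps, 0 < eps & forall s, `|s| <= eps ->
    negdef ((N0 + s *: N1)^T *m Q *m (N0 + s *: N1)).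
Proof.
move=> Qs /negdefN /posdef_coercive [C C0 HC].
have [C1 C10 HC1] := quad_bounded (N1^T *m Q *m N0).
have [C2 C20 HC2] := quad_bounded (N1^T *m Q *m N1).
(* For |s| <= 1 the terms in [s] and [s ^+ 2], multiplied by [C], are at most |s| [K] |x|^2; the
   radius below makes this less than |x|^2. *)
pose K := C * (2 * C1 + C2).
have K0 : 0 <= K by rewrite mulr_ge0 // addr_ge0 // mulr_ge0.
exists (2 * (1 + K))^-1; first by rewrite invr_gt0 mulr_gt0 // ltr_wpDr.
move=> s les; apply/negdefP; split=> [|x xN0]; first by rewrite !trmx_mul trmxK Qs mulmxA.
have -> : dot x ((N0 + s *: N1)^T *m Q *m (N0 + s *: N1) *m x) =
   dot x (N0^T *m Q *m N0 *m x) + 2 * s * dot x (N1^T *m Q *m N0 *m x)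
   + s ^+ 2 * dot x (N1^T *m Q *m N1 *m x).
  rewrite -!mulmxA -!dot_mull mulmxDl -scalemxAl mulmxDr -scalemxAr.
  rewrite !dotDl !dotDr !dotZl !dotZr.
  have -> : dot (N0 *m x) (Q *m (N1 *m x)) = dot (N1 *m x) (Q *m (N0 *m x)).
    by rewrite dotC dot_mull Qs.
  ring.
have := HC x; rewrite mulNmx dotNr mulrN; have := HC1 x; have := HC2 x.
have : 0 < dot x x by rewrite dot_gt0.
have s1 : `|s| * (1 + K) <= 2^-1.
  rewrite -ler_pdivlMr ?ltr_wpDr // -invfM; exact: les.
move: (dot x x) (dot x (N0^T *m Q *m N0 *m x)) => z q0.
move: (dot x (N1^T *m Q *m N0 *m x)) (dot x (N1^T *m Q *m N1 *m x)).
move=> q1 q2 z0 le_q2 le_q1 le_z; rewrite ltNge; apply/negP => tot0.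
have t0 := normr_ge0 s; set t := `|s| in s1 t0.
have t1 : t <= 1 by nra.
have sq1 : s * q1 <= t * (C1 * z).
  by apply: le_trans (ler_norm _) _; rewrite normrM ler_wpM2l.
have sq2 : s ^+ 2 * q2 <= t * (C2 * z).
  apply: le_trans (ler_norm _) _; rewrite normrM normrX.
  apply: ler_pM; rewrite ?exprn_ge0 // expr2 -[X in _ <= X]mulr1.
  exact: ler_wpM2l.
have : C * (q0 + 2 * s * q1 + s ^+ 2 * q2) <= - z + t * K * z.
  have -> : - z + t * K * z = - z + C * (2 * (t * (C1 * z)) + t * (C2 * z)).
    by rewrite /K; ring.
  rewrite -addrA mulrDr; apply: lerD; first by rewrite lerNr -lerN2 opprK in le_z *.
  by apply: ler_wpM2l => //; lra.
have := mulr_ge0 C0 tot0; nra.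
Qed.
End Dot.

(** * The performance form *)

Section PerformanceForm.
Variables (R : realType) (p q mp kp : nat) (gamma : R).
Variables (X : 'M[R]_p) (P : 'M[R]_q).
Variables (G11 : 'M[R]_(p + kp, p + mp)) (G12 : 'M[R]_(p + kp, q + mp)).
Variables (G21 : 'M[R]_(q + kp, p + mp)) (G22 : 'M[R]_(q + kp, q + mp)).

Definition performance_weight : 'M[R]_((p + p) + (q + q) + (mp + kp)) :=
  block_mx (block_mx (anti_diag X) 0 0 (anti_diag P)) 0 0
           (block_mx (- gamma%:M) 0 0 1%:M).

Lemma performance_weight_sym : X^T = X -> P^T = P ->
  performance_weight^T = performance_weight.
Proof.
move=> Xs Ps.
by rewrite !(tr_block_mx, trmx0) linearN /= tr_scalar_mx trmx1 Xs Ps.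
Qed.

Lemma performance_form_sym : X^T = X -> P^T = P ->
  (performance_form gamma X P G11 G12 G21 G22)^T =
  performance_form gamma X P G11 G12 G21 G22.
Proof.
move=> Xs Ps; rewrite /performance_form -/performance_weight.
by rewrite !trmx_mul trmxK performance_weight_sym // mulmxA.
Qed.

(** The inequality in dissipation form. All later comparisons are made between such scalar
    expressions, not between block matrices. *)
Lemma performance_quad x1 x2 w : X^T = X -> P^T = P ->
  let x := col_mx (col_mx x1 x2) w in
  let z := dlsubmx G11 *m x1 + dlsubmx G22 *m x2 + drsubmx G11 *m w in
  dot x (performance_form gamma X P G11 G12 G21 G22 *m x) =
  2 * (dot (X *m x1) (ulsubmx G11 *m x1 + ulsubmx G12 *m x2 + ursubmx G11 *m w)
     + dot (P *m x2) (ulsubmx G21 *m x1 + ulsubmx G22 *m x2 + ursubmx G22 *m w))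
  - gamma * dot w w + dot z z.
Proof.
move=> Xs Ps x z; rewrite /performance_form -!mulmxA -dot_mull.
have -> : outer_factor G11 G12 G21 G22 *m x = col_mx
    (col_mx (col_mx x1 (ulsubmx G11 *m x1 + ulsubmx G12 *m x2 + ursubmx G11 *m w))
            (col_mx x2 (ulsubmx G21 *m x1 + ulsubmx G22 *m x2 + ursubmx G22 *m w)))
    (col_mx w z).
  by rewrite /outer_factor !(mul_col_mx, mul_row_col) !(mul0mx, mul1mx, addr0, add0r).
rewrite !(mul_block_col, mul0mx, add0r, addr0, dot_col) mul1mx mulNmx mul_scalar_mx.
set r1 := _ + _ + _ *m w; set r2 := _ + _ + _ *m w.
have -> : dot x1 (X *m r1) = dot (X *m x1) r1 by rewrite dot_mull Xs.
have -> : dot x2 (P *m r2) = dot (P *m x2) r2 by rewrite dot_mull Ps.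
by rewrite dotNr dotZr (dotC r1) (dotC r2); ring.
Qed.

End PerformanceForm.

Lemma closed_loop_blockE (R : realType) di dj ci cj m k mp kp
    (A : 'M[R]_(di, dj)) (Bp : 'M[R]_(di, mp)) (B : 'M[R]_(di, m))
    (Cp : 'M[R]_(kp, dj)) (C : 'M[R]_(k, dj))
    (Dp : 'M[R]_(kp, mp)) (E : 'M[R]_(kp, m)) (F : 'M[R]_(k, mp))
    (Ac : 'M[R]_(ci, cj)) (Bc : 'M[R]_(ci, k))
    (Cc : 'M[R]_(m, cj)) (Dc : 'M[R]_(m, k)) :
  closed_loop_block A Bp B Cp C Dp E F Ac Bc Cc Dc =
  block_mx (block_mx (A + B *m Dc *m C) (B *m Cc) (Bc *m C) Ac)
           (col_mx (Bp + B *m Dc *m F) (Bc *m F))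
           (row_mx (Cp + E *m Dc *m C) (E *m Cc)) (Dp + E *m Dc *m F).
Proof.
rewrite /closed_loop_block mul_col_mx mulmx_block mul_row_block.
rewrite mul_col_mx mulmx_block mul_row_block !(mul0mx, mul1mx, add0r, addr0).
rewrite !mul_mx_row !(mulmx0, mulmx1) [X in _ + col_mx X _]block_mxEh.
rewrite -[col_mx (row_mx _ _) (row_mx _ _)]/(block_mx _ _ _ _) add_block_mx.
rewrite !(add_row_mx, add_col_mx) !(add0r, addr0).
by [].
Qed.

Lemma dot_inj (R : realType) n (u v : 'cV[R]_n) :
  (forall a, dot a u = dot a v) -> u = v.
Proof.
move=> uv; apply/eqP; rewrite -subr_eq0 -dot_eq0 dotDr dotNr uv.
by rewrite subrr.
Qed.

(** Proves identities between sums of vectors by pairing with an arbitrary vector, which leaves a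
    commutative ring identity in the scalar products. *)
Ltac vec := apply: dot_inj => ?;
  rewrite ?(mulmxDr, mulmxDl, mulmxN, mulNmx, mul1mx, mulmxA, dotDr, dotNr); ring.

Section SynthesisBlock.
Variables (R : realType) (di dj m1 m2 k1 k2 mp kp : nat).
Variables (A : 'M[R]_(di, dj)) (Bp : 'M[R]_(di, mp)) (B : 'M[R]_(di, m1 + m2)).
Variables (Cp : 'M[R]_(kp, dj)) (C : 'M[R]_(k1 + k2, dj)).
Variables (Dp : 'M[R]_(kp, mp)) (E : 'M[R]_(kp, m1 + m2)) (F : 'M[R]_(k1 + k2, mp)).
Variables (X : 'M[R]_(di, di + di)) (Y : 'M[R]_(dj, dj + dj)).
Variables (sK : 'M[R]_(di + di, dj + dj)) (sL : 'M[R]_(di + di, k1 + k2)).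
Variables (sM : 'M[R]_(m1 + m2, dj + dj)) (sN : 'M[R]_(m1 + m2, k1 + k2)).

Local Notation K := (K_of A B C X Y sK sL sM sN).
Local Notation L := (L_of B sL sN).
Local Notation M := (M_of C sM sN).

Lemma castmx_block p p' q a b (e : p = p')
    (aa : 'M[R]_(p, a)) (ab : 'M[R]_(p, b)) (ba : 'M[R]_(q, a)) (bb : 'M[R]_(q, b)) :
  castmx (congr1 (addn^~ q) e, erefl) (block_mx aa ab ba bb) =
  block_mx (castmx (e, erefl) aa) (castmx (e, erefl) ab) ba bb.
Proof. by case: _ / e; rewrite !castmx_id. Qed.

Lemma synthesis_blockE :
  synthesis_block A Bp B Cp C Dp E F X Y sK sL sM sN =
  block_mx
    (castmx (addnA di di di, erefl)
       (block_mx (A *m Y + B *m M) (A + B *m sN *m C) K (X^T *m A + L *m C)))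
    (castmx (addnA di di di, erefl)
       (col_mx (Bp + B *m sN *m F) (X^T *m Bp + L *m F)))
    (row_mx (Cp *m Y + E *m M) (Cp + E *m sN *m C)) (Dp + E *m sN *m F).
Proof.
rewrite -castmx_block /synthesis_block; congr castmx.
rewrite mul_col_mx mulmx_block mul_row_block !(mul0mx, mul1mx, add0r, addr0).
rewrite mul_col_mx mulmx_block mul_row_block.
rewrite !mul_mx_row !(mulmx0, mulmx1) [X in _ + col_mx X _]block_mxEh.
rewrite -[col_mx (row_mx _ _) (row_mx _ _)]/(block_mx _ _ _ _) add_block_mx.
rewrite !(add_row_mx, add_col_mx) !(add0r, addr0).
by [].
Qed.

End SynthesisBlock.

Lemma dot_castmx (R : realType) p p' q (e : p = p') (u : 'cV[R]_p)
    (M : 'M[R]_(p, q)) (v : 'cV[R]_q) :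
  dot (castmx (e, erefl) u) (castmx (e, erefl) M *m v) = dot u (M *m v).
Proof. by case: _ / e; rewrite !castmx_id. Qed.

Lemma col_mx_reassoc (R : realType) a b c (u : 'cV[R]_a) (v : 'cV[R]_b) (w : 'cV[R]_c) :
  col_mx (col_mx u v) w = castmx (addnA a b c, erefl) (col_mx u (col_mx v w)).
Proof.
rewrite col_mxA castmx_comp castmx_id //.
Qed.

Section Interconnection.
Variables (R : realType) (d1 d2 m1 m2 k1 k2 mp kp : nat) (gamma : R).
Local Notation m := (m1 + m2)%N.
Local Notation k := (k1 + k2)%N.
Variables (A11 : 'M[R]_(d1, d1)) (A12 : 'M[R]_(d1, d2)).
Variables (A21 : 'M[R]_(d2, d1)) (A22 : 'M[R]_(d2, d2)).
Variables (Bp1 : 'M[R]_(d1, mp)) (Bp2 : 'M[R]_(d2, mp)).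
Variables (B1 : 'M[R]_(d1, m)) (B2 : 'M[R]_(d2, m)).
Variables (Cp1 : 'M[R]_(kp, d1)) (Cp2 : 'M[R]_(kp, d2)).
Variables (C1 : 'M[R]_(k, d1)) (C2 : 'M[R]_(k, d2)).
Variables (Dp : 'M[R]_(kp, mp)) (E : 'M[R]_(kp, m)) (F : 'M[R]_(k, mp)).

Section ClosedLoop.
Variables c1 c2 : nat.
Variables (Ac11 : 'M[R]_(c1, c1)) (Ac12 : 'M[R]_(c1, c2)).
Variables (Ac21 : 'M[R]_(c2, c1)) (Ac22 : 'M[R]_(c2, c2)).
Variables (Bc1 : 'M[R]_(c1, k)) (Bc2 : 'M[R]_(c2, k)).
Variables (Cc1 : 'M[R]_(m, c1)) (Cc2 : 'M[R]_(m, c2)) (Dc : 'M[R]_(m, k)).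
Variables (Xi1 : 'M[R]_(d1 + c1)) (Xi2 : 'M[R]_(d2 + c2)).

(** [yy] and [u] are the measurement and the control. The matrices [Xi1] and [Xi2] enter only
    through their values at the given vectors, which is what a relation [Xi calY = calZ]
    provides. *)
Lemma closed_loop_quad y1 q1 y2 q2 w xi1 z1 xi2 z2 :
  Xi1^T = Xi1 -> Xi2^T = Xi2 ->
  Xi1 *m col_mx y1 q1 = col_mx xi1 z1 -> Xi2 *m col_mx y2 q2 = col_mx xi2 z2 ->
  let x := col_mx (col_mx (col_mx y1 q1) (col_mx y2 q2)) w in
  let yy := C1 *m y1 + C2 *m y2 + F *m w in
  let u := Cc1 *m q1 + Cc2 *m q2 + Dc *m yy in
  let z := Cp1 *m y1 + Cp2 *m y2 + Dp *m w + E *m u in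
  dot x (performance_form gamma Xi1 Xi2
    (closed_loop_block A11 Bp1 B1 Cp1 C1 Dp E F Ac11 Bc1 Cc1 Dc)
    (closed_loop_block A12 Bp1 B1 Cp2 C2 Dp E F Ac12 Bc1 Cc2 Dc)
    (closed_loop_block A21 Bp2 B2 Cp1 C1 Dp E F Ac21 Bc2 Cc1 Dc)
    (closed_loop_block A22 Bp2 B2 Cp2 C2 Dp E F Ac22 Bc2 Cc2 Dc) *m x) =
  2 * (dot xi1 (A11 *m y1 + A12 *m y2 + Bp1 *m w + B1 *m u)
     + dot z1 (Ac11 *m q1 + Ac12 *m q2 + Bc1 *m yy)
     + (dot xi2 (A21 *m y1 + A22 *m y2 + Bp2 *m w + B2 *m u)
     + dot z2 (Ac21 *m q1 + Ac22 *m q2 + Bc2 *m yy)))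
  - gamma * dot w w + dot z z.
Proof.
move=> X1s X2s X1x X2x x yy u z; rewrite performance_quad //.
rewrite !closed_loop_blockE !(block_mxKul, block_mxKur, block_mxKdl, block_mxKdr).
rewrite X1x X2x !(mul_block_col, mul_row_col, mul_col_mx, add_col_mx, dot_col).
congr (2 * (_ + _ + (_ + _)) - _ + _).
- by congr dot; rewrite /u /yy; vec.
- by congr dot; rewrite /u /yy; vec.
- by congr dot; rewrite /u /yy; vec.
- by congr dot; rewrite /u /yy; vec.
- by congr dot; rewrite /z /u /yy; vec.
Qed.

End ClosedLoop.

Section SynthesisLmi.
Variables (X1 : 'M[R]_(d1, d1 + d1)) (Y1 : 'M[R]_(d1, d1 + d1)).
Variables (X2 : 'M[R]_(d2, d2 + d2)) (Y2 : 'M[R]_(d2, d2 + d2)).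
Variables (sK11 : 'M[R]_(d1 + d1, d1 + d1)) (sK12 : 'M[R]_(d1 + d1, d2 + d2)).
Variables (sK21 : 'M[R]_(d2 + d2, d1 + d1)) (sK22 : 'M[R]_(d2 + d2, d2 + d2)).
Variables (sL1 : 'M[R]_(d1 + d1, k)) (sL2 : 'M[R]_(d2 + d2, k)).
Variables (sM1 : 'M[R]_(m, d1 + d1)) (sM2 : 'M[R]_(m, d2 + d2)) (sN : 'M[R]_(m, k)).

(** Here [y1] and [y2] play the role of the plant signals. The measurement [yy] contains only the
    [g] parts, since the part coming from [Y] is contained in [M_of] and [K_of]. *)
Lemma synthesis_quad (a1 b1 g1 : 'cV[R]_d1) (a2 b2 g2 : 'cV[R]_d2) w :
  let x := col_mx (col_mx (col_mx (col_mx a1 b1) g1) (col_mx (col_mx a2 b2) g2)) w in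
  let e1 := col_mx a1 b1 in let e2 := col_mx a2 b2 in
  let y1 := Y1 *m e1 + g1 in let y2 := Y2 *m e2 + g2 in
  let yy := C1 *m g1 + C2 *m g2 + F *m w in
  let u := M_of C1 sM1 sN *m e1 + M_of C2 sM2 sN *m e2 + sN *m yy in
  let z := Cp1 *m y1 + Cp2 *m y2 + Dp *m w + E *m u in
  dot x (performance_form gamma 1%:M 1%:M
    (synthesis_block A11 Bp1 B1 Cp1 C1 Dp E F X1 Y1 sK11 sL1 sM1 sN)
    (synthesis_block A12 Bp1 B1 Cp2 C2 Dp E F X1 Y2 sK12 sL1 sM2 sN)
    (synthesis_block A21 Bp2 B2 Cp1 C1 Dp E F X2 Y1 sK21 sL2 sM1 sN)
    (synthesis_block A22 Bp2 B2 Cp2 C2 Dp E F X2 Y2 sK22 sL2 sM2 sN) *m x) =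
  2 * (dot a1 (A11 *m y1 + A12 *m y2 + Bp1 *m w + B1 *m u)
     + dot (col_mx b1 g1) (X1^T *m (A11 *m g1 + A12 *m g2 + Bp1 *m w)
         + K_of A11 B1 C1 X1 Y1 sK11 sL1 sM1 sN *m e1
         + K_of A12 B1 C2 X1 Y2 sK12 sL1 sM2 sN *m e2 + L_of B1 sL1 sN *m yy)
     + (dot a2 (A21 *m y1 + A22 *m y2 + Bp2 *m w + B2 *m u)
     + dot (col_mx b2 g2) (X2^T *m (A21 *m g1 + A22 *m g2 + Bp2 *m w)
         + K_of A21 B2 C1 X2 Y1 sK21 sL2 sM1 sN *m e1
         + K_of A22 B2 C2 X2 Y2 sK22 sL2 sM2 sN *m e2 + L_of B2 sL2 sN *m yy)))
  - gamma * dot w w + dot z z.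
Proof.
move=> x e1 e2 y1 y2 yy u z; rewrite performance_quad ?trmx1 //.
rewrite !synthesis_blockE !(block_mxKul, block_mxKur, block_mxKdl, block_mxKdr).
rewrite !mul1mx !dotDr ![in X in 2 * X]col_mx_reassoc !dot_castmx.
rewrite -!col_mx_reassoc -!dotDr !(mul_block_col, mul_row_col, mul_col_mx, add_col_mx, dot_col).
rewrite -/e1 -/e2.
congr (2 * (_ + _ + (_ + _)) - _ + _).
- by congr dot; rewrite /u /yy /y1 /y2; vec.
- by congr dot; rewrite /u /yy; vec.
- by congr dot; rewrite /u /yy /y1 /y2; vec.
- by congr dot; rewrite /u /yy; vec.
- by congr dot; rewrite /z /u /yy /y1 /y2; vec.
Qed.

End SynthesisLmi.

Section SynthesisShift.
Variables (X1 : 'M[R]_(d1, d1 + d1)) (Y1 : 'M[R]_(d1, d1 + d1)).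
Variables (X2 : 'M[R]_(d2, d2 + d2)) (Y2 : 'M[R]_(d2, d2 + d2)).
Variables (sK11 : 'M[R]_(d1 + d1, d1 + d1)) (sK12 : 'M[R]_(d1 + d1, d2 + d2)).
Variables (sK21 : 'M[R]_(d2 + d2, d1 + d1)) (sK22 : 'M[R]_(d2 + d2, d2 + d2)).
Variables (sL1 : 'M[R]_(d1 + d1, k)) (sL2 : 'M[R]_(d2 + d2, k)).
Variables (sM1 : 'M[R]_(m, d1 + d1)) (sM2 : 'M[R]_(m, d2 + d2)) (sN : 'M[R]_(m, k)).

(** [sK11] and [sK22] enter the form affinely, each through one inner product within its own
    channel; this lets [damping] act on the two channels separately. *)
Lemma synthesis_quad_shift s (D1 : 'M[R]_(d1 + d1)) (D2 : 'M[R]_(d2 + d2))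
    (a1 b1 g1 : 'cV[R]_d1) (a2 b2 g2 : 'cV[R]_d2) w :
  let x := col_mx (col_mx (col_mx (col_mx a1 b1) g1) (col_mx (col_mx a2 b2) g2)) w in
  let form sK11 sK22 := performance_form gamma 1%:M 1%:M
    (synthesis_block A11 Bp1 B1 Cp1 C1 Dp E F X1 Y1 sK11 sL1 sM1 sN)
    (synthesis_block A12 Bp1 B1 Cp2 C2 Dp E F X1 Y2 sK12 sL1 sM2 sN)
    (synthesis_block A21 Bp2 B2 Cp1 C1 Dp E F X2 Y1 sK21 sL2 sM1 sN)
    (synthesis_block A22 Bp2 B2 Cp2 C2 Dp E F X2 Y2 sK22 sL2 sM2 sN) in
  dot x (form (sK11 + s *: D1) (sK22 + s *: D2) *m x) =
  dot x (form sK11 sK22 *m x)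
  + s * (2 * dot (col_mx b1 g1) (D1 *m col_mx a1 b1)
       + 2 * dot (col_mx b2 g2) (D2 *m col_mx a2 b2)).
Proof.
have KD di dj (A : 'M[R]_(di, dj)) B C X Y sK D sL sM (e : 'cV_(dj + dj)) :
    K_of A B C X Y (sK + s *: D) sL sM sN *m e =
    K_of A B C X Y sK sL sM sN *m e + s *: (D *m e).
  rewrite scalemxAl -mulmxDl; congr (_ *m _).
  by rewrite /K_of -!addrA; congr (_ + _); rewrite addrC -!addrA.
have shift1 p (t x0 x1 x2 x3 d : 'cV[R]_p) :
    dot t (x0 + (x1 + s *: d) + x2 + x3) = dot t (x0 + x1 + x2 + x3) + s * dot t d.
  by rewrite !dotDr dotZr; ring.
have shift2 p (t x0 x1 x2 x3 d : 'cV[R]_p) :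
    dot t (x0 + x1 + (x2 + s *: d) + x3) = dot t (x0 + x1 + x2 + x3) + s * dot t d.
  by rewrite !dotDr dotZr; ring.
move=> x form; rewrite /form /x [LHS]synthesis_quad [X in _ = X + _]synthesis_quad.
rewrite (KD _ _ A11) shift1 (KD _ _ A22) shift2.
set t6 := dot _ (D1 *m _); set t7 := dot _ (D2 *m _).
set t1 := dot a1 _; set t3 := dot a2 _; set t5 := dot w w.
set t2 := dot (col_mx b1 g1) _; set t4 := dot (col_mx b2 g2) _.
move: (dot _ _) => t8; ring.
Qed.

End SynthesisShift.

End Interconnection.

(** * Triangular structure and congruence *)

(** Registers block extraction as linear, so that [linearD], [linearZ] and [linear0] apply to it. *)
HB.instance Definition _ (R : pzRingType) m1 m2 n1 n2 :=
  GRing.Linear.copy (@ulsubmx R m1 m2 n1 n2) (lsubmx \o usubmx).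
HB.instance Definition _ (R : pzRingType) m1 m2 n1 n2 :=
  GRing.Linear.copy (@ursubmx R m1 m2 n1 n2) (rsubmx \o usubmx).
HB.instance Definition _ (R : pzRingType) m1 m2 n1 n2 :=
  GRing.Linear.copy (@dlsubmx R m1 m2 n1 n2) (lsubmx \o dsubmx).
HB.instance Definition _ (R : pzRingType) m1 m2 n1 n2 :=
  GRing.Linear.copy (@drsubmx R m1 m2 n1 n2) (rsubmx \o dsubmx).

Section TwoByTwo.
Variables (R : realType) (a1 a2 b1 b2 c1 c2 : nat).
Implicit Types (A : 'M[R]_(a1 + a2, b1 + b2)) (B : 'M[R]_(b1 + b2, c1 + c2)).

Lemma ulsubmx_mul A B :
  ulsubmx (A *m B) = ulsubmx A *m ulsubmx B + ursubmx A *m dlsubmx B.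
Proof. by rewrite -{1}[A]submxK -{1}[B]submxK mulmx_block block_mxKul. Qed.

Lemma ursubmx_mul A B :
  ursubmx (A *m B) = ulsubmx A *m ursubmx B + ursubmx A *m drsubmx B.
Proof. by rewrite -{1}[A]submxK -{1}[B]submxK mulmx_block block_mxKur. Qed.

Lemma drsubmx_mul A B :
  drsubmx (A *m B) = dlsubmx A *m ursubmx B + drsubmx A *m drsubmx B.
Proof. by rewrite -{1}[A]submxK -{1}[B]submxK mulmx_block block_mxKdr. Qed.

Lemma lower_block_tri_mul A B :
  lower_block_tri A -> lower_block_tri B -> lower_block_tri (A *m B).
Proof.
by rewrite /lower_block_tri ursubmx_mul => -> ->; rewrite mulmx0 mul0mx addr0.
Qed.

End TwoByTwo.

Section Channel.
Variables (R : realType) (di dj m1 m2 k1 k2 : nat).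
Variables (A : 'M[R]_(di, dj)) (B : 'M[R]_(di, m1 + m2)) (C : 'M[R]_(k1 + k2, dj)).
Variables (S2 S3 : 'M[R]_di) (T1 T2 : 'M[R]_dj).
Local Notation X := (row_mx S2 S3).
Local Notation Y := (row_mx T1 T2).
Variables (sK : 'M[R]_(di + di, dj + dj)) (sL : 'M[R]_(di + di, k1 + k2)).
Variables (sM : 'M[R]_(m1 + m2, dj + dj)) (N : 'M[R]_(m1 + m2, k1 + k2)).
Variables (Ac : 'M[R]_(di + di, dj + dj)) (Bc : 'M[R]_(di + di, k1 + k2)).
Variables (Cc : 'M[R]_(m1 + m2, dj + dj)).
Hypothesis S2B : S2^T *m rsubmx B = rsubmx B.
Hypothesis CT2 : usubmx C *m T2 = usubmx C.
Hypothesis N_tri : lower_block_tri N.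

Lemma ursubmx_XB : ursubmx (X^T *m B) = rsubmx B.
Proof.
rewrite /ursubmx tr_row_mx mul_col_mx col_mxKu.
by rewrite -[in LHS](hsubmxK B) mul_mx_row row_mxKr.
Qed.

Lemma ursubmx_CY : ursubmx (C *m Y) = usubmx C.
Proof.
rewrite -[ursubmx _]trmxK trmx_ursub /dlsubmx mul_mx_row tr_row_mx col_mxKd trmx_mul.
by rewrite -[in LHS](vsubmxK C) tr_col_mx mul_mx_row row_mxKl -trmx_mul trmxK.
Qed.

Lemma ulsubmx_ext_B q1 q2 (J : 'M[R]_(m1 + m2, q1 + q2)) :
  ulsubmx (ext_B B *m J) = rsubmx B *m dlsubmx J.
Proof. by rewrite ulsubmx_mul block_mxKul block_mxKur mul0mx add0r. Qed.

Lemma ursubmx_ext_B q1 q2 (J : 'M[R]_(m1 + m2, q1 + q2)) :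
  ursubmx (ext_B B *m J) = rsubmx B *m drsubmx J.
Proof. by rewrite ursubmx_mul block_mxKul block_mxKur mul0mx add0r. Qed.

Lemma ursubmx_ext_C p1 p2 (J : 'M[R]_(p1 + p2, k1 + k2)) :
  ursubmx (J *m ext_C C) = ulsubmx J *m usubmx C.
Proof. by rewrite ursubmx_mul block_mxKur block_mxKdr mulmx0 addr0. Qed.

Hypothesis LE : L_of B sL N = Bc + X^T *m B *m N.
Hypothesis ME : M_of C sM N = Cc + N *m C *m Y.

(** The correction in [L_of] is the upper right block of X^T B N: by [S2B] and triangularity of [N],
    that block involves only the last columns of [B] and the lower right block of [N]. *)
Lemma ursubmx_L : ursubmx Bc = ursubmx sL.
Proof.
move: (congr1 (@ursubmx _ _ _ _ _) LE); rewrite !linearD /= block_mxKur.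
by rewrite ursubmx_ext_B ursubmx_mul ursubmx_XB N_tri mulmx0 add0r => /addIr.
Qed.

Lemma ursubmx_M : ursubmx Cc = ursubmx sM.
Proof.
move: (congr1 (@ursubmx _ _ _ _ _) ME); rewrite !linearD /= block_mxKur.
by rewrite ursubmx_ext_C -mulmxA ursubmx_mul ursubmx_CY N_tri mul0mx addr0 => /addIr.
Qed.

Hypothesis KE : K_of A B C X Y sK sL sM N =
  Ac + X^T *m B *m Cc + Bc *m C *m Y + X^T *m B *m N *m C *m Y + X^T *m A *m Y.
Hypothesis sL_tri : lower_block_tri sL.
Hypothesis sM_tri : lower_block_tri sM.

(** Expand the corner of every product in [KE]. The plant term cancels at once; after [sL] and [sM]
    are expressed through [Bc] and [Cc], the term with [N] is counted twice, and the subtracted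
    product in [K_of] removes the surplus. *)
Lemma ursubmx_K : ursubmx Ac = ursubmx sK.
Proof.
have Bc0 : ursubmx Bc = 0 by rewrite ursubmx_L.
have Cc0 : ursubmx Cc = 0 by rewrite ursubmx_M.
have ulL : ulsubmx sL = ulsubmx Bc + ulsubmx (X^T *m B *m N).
  by have := congr1 (@ulsubmx _ _ _ _ _) LE; rewrite !linearD /= block_mxKul addr0.
have drM : drsubmx sM = drsubmx Cc + drsubmx (N *m (C *m Y)).
  have := congr1 (@drsubmx _ _ _ _ _) ME; rewrite !linearD /= block_mxKdr addr0.
  by rewrite mulmxA.
move: (congr1 (@ursubmx _ _ _ _ _) KE); rewrite /K_of /upper_part.
rewrite -[Bc *m C *m Y]mulmxA -[_ *m C *m Y]mulmxA.
rewrite !linearD /= linearN /= !block_mxKur !ursubmx_ext_C !ursubmx_ext_B.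
rewrite ulsubmx_ext_B ulL drM.
rewrite [ursubmx (X^T *m B *m Cc)]ursubmx_mul [ursubmx (Bc *m _)]ursubmx_mul.
rewrite [ursubmx (_ *m (C *m Y))]ursubmx_mul [drsubmx (N *m _)]drsubmx_mul.
rewrite [ursubmx (X^T *m B *m N)]ursubmx_mul.
rewrite Bc0 Cc0 N_tri ursubmx_XB ursubmx_CY !(mul0mx, mulmx0, add0r, addr0).
rewrite mulmxDl !mulmxDr !mulmxA.
move: (ursubmx (X^T *m A *m Y)) (rsubmx B *m drsubmx Cc) => t1 t2.
move: (rsubmx B *m dlsubmx N *m _) (ulsubmx Bc *m _) => t3 t4.
move: (rsubmx B *m drsubmx N *m _) (ulsubmx (X^T *m B *m N) *m _) => t5 t6.
move/matrixP => KEur; apply/matrixP => i j; have := KEur i j.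
rewrite !mxE; lra.
Qed.

End Channel.

(** The relation [Xi calY = calZ], tested on vectors [a; b; g]. This avoids reassociating the
    columns of [calY] and [calZ]. *)
Definition congruence (R : realType) d c (Xi : 'M[R]_(d + c))
    (X Y : 'M[R]_(d, d + d)) (U V : 'M[R]_(c, d + d)) : Prop :=
  forall a b g : 'cV[R]_d,
    Xi *m col_mx (Y *m col_mx a b + g) (V *m col_mx a b) =
    col_mx (a + X *m col_mx b g) (U *m col_mx b g).

Section Congruence.
Variables (R : realType) (d1 d2 m1 m2 k1 k2 mp kp : nat) (gamma : R).
Local Notation m := (m1 + m2)%N.
Local Notation k := (k1 + k2)%N.
Variables (A11 : 'M[R]_(d1, d1)) (A12 : 'M[R]_(d1, d2)).
Variables (A21 : 'M[R]_(d2, d1)) (A22 : 'M[R]_(d2, d2)).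
Variables (Bp1 : 'M[R]_(d1, mp)) (Bp2 : 'M[R]_(d2, mp)).
Variables (B1 : 'M[R]_(d1, m)) (B2 : 'M[R]_(d2, m)).
Variables (Cp1 : 'M[R]_(kp, d1)) (Cp2 : 'M[R]_(kp, d2)).
Variables (C1 : 'M[R]_(k, d1)) (C2 : 'M[R]_(k, d2)).
Variables (Dp : 'M[R]_(kp, mp)) (E : 'M[R]_(kp, m)) (F : 'M[R]_(k, mp)).
Variables c1 c2 : nat.
Variables (Ac11 : 'M[R]_(c1, c1)) (Ac12 : 'M[R]_(c1, c2)).
Variables (Ac21 : 'M[R]_(c2, c1)) (Ac22 : 'M[R]_(c2, c2)).
Variables (Bc1 : 'M[R]_(c1, k)) (Bc2 : 'M[R]_(c2, k)).
Variables (Cc1 : 'M[R]_(m, c1)) (Cc2 : 'M[R]_(m, c2)) (Dc : 'M[R]_(m, k)).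
Variables (X1 Y1 : 'M[R]_(d1, d1 + d1)) (X2 Y2 : 'M[R]_(d2, d2 + d2)).
Variables (U1 V1 : 'M[R]_(c1, d1 + d1)) (U2 V2 : 'M[R]_(c2, d2 + d2)).
Variables (Xi1 : 'M[R]_(d1 + c1)) (Xi2 : 'M[R]_(d2 + c2)).
Variables (sK11 : 'M[R]_(d1 + d1, d1 + d1)) (sK12 : 'M[R]_(d1 + d1, d2 + d2)).
Variables (sK21 : 'M[R]_(d2 + d2, d1 + d1)) (sK22 : 'M[R]_(d2 + d2, d2 + d2)).
Variables (sL1 : 'M[R]_(d1 + d1, k)) (sL2 : 'M[R]_(d2 + d2, k)).
Variables (sM1 : 'M[R]_(m, d1 + d1)) (sM2 : 'M[R]_(m, d2 + d2)).

Hypotheses (Xi1_sym : Xi1^T = Xi1) (Xi2_sym : Xi2^T = Xi2).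
Hypotheses (Xi1_cong : congruence Xi1 X1 Y1 U1 V1).
Hypotheses (Xi2_cong : congruence Xi2 X2 Y2 U2 V2).
Hypotheses (L1E : L_of B1 sL1 Dc = U1^T *m Bc1 + X1^T *m B1 *m Dc).
Hypotheses (L2E : L_of B2 sL2 Dc = U2^T *m Bc2 + X2^T *m B2 *m Dc).
Hypotheses (M1E : M_of C1 sM1 Dc = Cc1 *m V1 + Dc *m C1 *m Y1).
Hypotheses (M2E : M_of C2 sM2 Dc = Cc2 *m V2 + Dc *m C2 *m Y2).
Hypotheses (K11E : K_of A11 B1 C1 X1 Y1 sK11 sL1 sM1 Dc =
  U1^T *m Ac11 *m V1 + X1^T *m B1 *m (Cc1 *m V1) + U1^T *m Bc1 *m C1 *m Y1
  + X1^T *m B1 *m Dc *m C1 *m Y1 + X1^T *m A11 *m Y1).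
Hypotheses (K12E : K_of A12 B1 C2 X1 Y2 sK12 sL1 sM2 Dc =
  U1^T *m Ac12 *m V2 + X1^T *m B1 *m (Cc2 *m V2) + U1^T *m Bc1 *m C2 *m Y2
  + X1^T *m B1 *m Dc *m C2 *m Y2 + X1^T *m A12 *m Y2).
Hypotheses (K21E : K_of A21 B2 C1 X2 Y1 sK21 sL2 sM1 Dc =
  U2^T *m Ac21 *m V1 + X2^T *m B2 *m (Cc1 *m V1) + U2^T *m Bc2 *m C1 *m Y1
  + X2^T *m B2 *m Dc *m C1 *m Y1 + X2^T *m A21 *m Y1).
Hypotheses (K22E : K_of A22 B2 C2 X2 Y2 sK22 sL2 sM2 Dc =
  U2^T *m Ac22 *m V2 + X2^T *m B2 *m (Cc2 *m V2) + U2^T *m Bc2 *m C2 *m Y2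
  + X2^T *m B2 *m Dc *m C2 *m Y2 + X2^T *m A22 *m Y2).

(** [x] is [calY] applied to [v] in each channel. The congruence replaces [Xi x] by [calZ v], and
    the transposes of [U] and [X] move onto the controller and plant rows, where they produce the
    transformed matrices. *)
Lemma synthesis_closed_loop_quad (a1 b1 g1 : 'cV[R]_d1) (a2 b2 g2 : 'cV[R]_d2) w :
  let v := col_mx (col_mx (col_mx (col_mx a1 b1) g1) (col_mx (col_mx a2 b2) g2)) w in
  let e1 := col_mx a1 b1 in let e2 := col_mx a2 b2 in
  let x := col_mx (col_mx (col_mx (Y1 *m e1 + g1) (V1 *m e1))
                          (col_mx (Y2 *m e2 + g2) (V2 *m e2))) w in
  dot v (performance_form gamma 1%:M 1%:M
    (synthesis_block A11 Bp1 B1 Cp1 C1 Dp E F X1 Y1 sK11 sL1 sM1 Dc)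
    (synthesis_block A12 Bp1 B1 Cp2 C2 Dp E F X1 Y2 sK12 sL1 sM2 Dc)
    (synthesis_block A21 Bp2 B2 Cp1 C1 Dp E F X2 Y1 sK21 sL2 sM1 Dc)
    (synthesis_block A22 Bp2 B2 Cp2 C2 Dp E F X2 Y2 sK22 sL2 sM2 Dc) *m v) =
  dot x (performance_form gamma Xi1 Xi2
    (closed_loop_block A11 Bp1 B1 Cp1 C1 Dp E F Ac11 Bc1 Cc1 Dc)
    (closed_loop_block A12 Bp1 B1 Cp2 C2 Dp E F Ac12 Bc1 Cc2 Dc)
    (closed_loop_block A21 Bp2 B2 Cp1 C1 Dp E F Ac21 Bc2 Cc1 Dc)
    (closed_loop_block A22 Bp2 B2 Cp2 C2 Dp E F Ac22 Bc2 Cc2 Dc) *m x).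
Proof.
move=> v e1 e2 x; rewrite synthesis_quad.
rewrite (@closed_loop_quad R d1 d2 m1 m2 k1 k2 mp kp gamma
  A11 A12 A21 A22 Bp1 Bp2 B1 B2 Cp1 Cp2 C1 C2 Dp E F c1 c2
  Ac11 Ac12 Ac21 Ac22 Bc1 Bc2 Cc1 Cc2 Dc Xi1 Xi2 _ _ _ _ w _ _ _ _
  Xi1_sym Xi2_sym (Xi1_cong a1 b1 g1) (Xi2_cong a2 b2 g2)).
rewrite -/e1 -/e2.
set y1 := Y1 *m e1 + g1; set y2 := Y2 *m e2 + g2; set q1 := V1 *m e1; set q2 := V2 *m e2.
set yy := C1 *m y1 + C2 *m y2 + F *m w.
set u := Cc1 *m q1 + Cc2 *m q2 + Dc *m yy.
(* Both forms see the same control, hence the same performance output. *)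
have -> : M_of C1 sM1 Dc *m e1 + M_of C2 sM2 Dc *m e2
    + Dc *m (C1 *m g1 + C2 *m g2 + F *m w) = u.
  by rewrite M1E M2E /u /yy /q1 /q2 /y1 /y2; vec.
congr (2 * _ - _ + _); rewrite K11E K12E K21E K22E L1E L2E.
set s1 := A11 *m y1 + A12 *m y2 + Bp1 *m w + B1 *m u.
set s2 := A21 *m y1 + A22 *m y2 + Bp2 *m w + B2 *m u.
congr (_ + _); rewrite [in RHS]dotDl !dot_mull -[RHS]addrA -dotDr;
  congr (_ + dot _ _).
- by rewrite /s1 /u /yy /q1 /q2 /y1 /y2; vec.
- by rewrite /s2 /u /yy /q1 /q2 /y1 /y2; vec.
Qed.
End Congruence.

(** * Completion and extraction of Lyapunov and multiplier matrices *)

Section Construction.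
Variables (R : realType) (d : nat) (S2 S3 T1 T2 : 'M[R]_d).
Hypotheses (S3s : S3^T = S3) (T1s : T1^T = T1) (T2S2s : (T2^T *m S2)^T = T2^T *m S2).

(** With [V = I], the matrix [U] is forced by requiring that calY^T calZ be the symmetric
    [coupling_mx]. *)
Definition completion_U : 'M[R]_(d + d) :=
  block_mx (T2 - T1 *m S2) (1%:M - T1 *m S3) 0 (S2^T - T2^T *m S3).

(** This is calZ calY^-1 for [V = I]: the first block column is read off [0; 0; g], the rest from
    [a; b; 0]. *)
Definition completion_mx : 'M[R]_(d + (d + d)) :=
  block_mx S3 (row_mx (1%:M - S3 *m T1) (S2 - S3 *m T2))
    (col_mx (1%:M - T1 *m S3) (S2^T - T2^T *m S3))
    (block_mx (T1 *m S3 *m T1 - T1) (T1 *m S3 *m T2 - T1 *m S2)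
       (T2^T *m S3 *m T1 - S2^T *m T1) (T2^T *m S3 *m T2 - T2^T *m S2)).

Let S2T2 : S2^T *m T2 = T2^T *m S2.
Proof. by rewrite -[LHS]trmxK trmx_mul trmxK T2S2s. Qed.

Lemma completion_mx_sym : completion_mx^T = completion_mx.
Proof.
have S3T2 : (T2^T *m S3 *m T2)^T = T2^T *m S3 *m T2 by rewrite !trmx_mul trmxK S3s mulmxA.
have T1S3T1 : (T1 *m S3 *m T1)^T = T1 *m S3 *m T1 by rewrite !trmx_mul S3s T1s mulmxA.
rewrite /completion_mx !(tr_block_mx, tr_row_mx, tr_col_mx) S3s.
congr block_mx; last congr block_mx.
- by congr row_mx; rewrite linearB /= !trmx_mul ?trmxK ?trmx1 S3s ?T1s.
- by congr col_mx; rewrite linearB /= !trmx_mul ?trmx1 S3s ?T1s.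
- by rewrite linearB /= T1S3T1 T1s.
- by rewrite linearB /= !trmx_mul !trmxK S3s T1s mulmxA.
- by rewrite linearB /= !trmx_mul S3s T1s mulmxA.
- by rewrite linearB /= S3T2 T2S2s.
Qed.

Lemma completion_mx_congruence :
  congruence completion_mx (row_mx S2 S3) (row_mx T1 T2) completion_U 1%:M.
Proof.
move=> a b g; rewrite mul1mx /completion_mx /completion_U.
rewrite !(mul_block_col, mul_row_col, mul_col_mx).
rewrite !mul0mx add0r !add_col_mx; congr col_mx; [by vec | congr col_mx].
- by vec.
- by rewrite -S2T2; vec.
Qed.

(* [bbX] without the structure that [S2] and [T2] have there.                 *)
Definition coupling_mx : 'M[R]_(d + d + d) :=
  block_mx (block_mx T1 T2 T2^T (T2^T *m S2)) (col_mx 1%:M S2^T) (row_mx 1%:M S2) S3.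

Lemma coupling_mx_sym : coupling_mx^T = coupling_mx.
Proof.
rewrite /coupling_mx !(tr_block_mx, tr_row_mx, tr_col_mx) S3s T2S2s T1s.
by rewrite !trmxK !trmx1.
Qed.

Lemma coupling_quad (a b g : 'cV[R]_d) :
  let v := col_mx (col_mx a b) g in
  dot v (coupling_mx *m v) =
  dot a (T1 *m a + T2 *m b + g) + dot b (T2^T *m a + T2^T *m (S2 *m b) + S2^T *m g)
  + dot g (a + S2 *m b + S3 *m g).
Proof.
rewrite /coupling_mx !(mul_block_col, mul_col_mx, mul_row_col, add_col_mx, dot_col).
by rewrite !mul1mx !mulmxA.
Qed.

Lemma completion_mx_quad (a b g : 'cV[R]_d) :
  let x := col_mx (row_mx T1 T2 *m col_mx a b + g) (col_mx a b) in
  let v := col_mx (col_mx a b) g in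
  dot x (completion_mx *m x) = dot v (coupling_mx *m v).
Proof.
move=> x v; have := completion_mx_congruence a b g; rewrite mul1mx => ->.
rewrite coupling_quad /completion_U !(mul_block_col, mul_row_col, dot_col) mul0mx add0r.
rewrite !(dotDl, dotDr, dot_mull, mulmxBl, mulmxDr, mulmxA, mul1mx, dotNr) T1s.
ring.
Qed.

(** For [V = I] the matrix [calY] is onto, so no vector escapes the congruence. *)
Lemma completion_split (x : 'cV[R]_(d + (d + d))) : exists a b g : 'cV[R]_d,
  x = col_mx (row_mx T1 T2 *m col_mx a b + g) (1%:M *m col_mx a b).
Proof.
exists (usubmx (dsubmx x)), (dsubmx (dsubmx x)).
exists (usubmx x - row_mx T1 T2 *m dsubmx x).
by rewrite mul1mx vsubmxK addrC subrK vsubmxK.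
Qed.

Lemma completion_mx_posdef : posdef coupling_mx -> posdef completion_mx.
Proof.
move=> /posdefP [_ Kpos]; apply/posdefP; split=> [|x]; first exact: completion_mx_sym.
have [a [b [g ->]]] := completion_split x; rewrite mul1mx => x0.
rewrite completion_mx_quad; apply: Kpos; apply: contraNN x0.
rewrite !col_mx_eq0 => /andP [/andP [/eqP -> /eqP ->] /eqP ->].
by rewrite !col_mx0 mulmx0 addr0 !eqxx.
Qed.

(** If U [b; g] = 0, take a = - X [b; g]. Then [calZ], hence [Xi calY], vanishes at [a; b; g];
    definiteness of [Xi] and injectivity of [calY] give b = g = 0. *)
Lemma completion_U_unit : posdef coupling_mx -> completion_U \in unitmx.
Proof.
move=> /completion_mx_posdef /posdefP [_ Xipos]; apply: unitmx_inj => y Uy.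
rewrite -[y]vsubmxK in Uy *; set b := usubmx y in Uy *; set g := dsubmx y in Uy *.
have := completion_mx_congruence (- (row_mx S2 S3 *m col_mx b g)) b g.
rewrite Uy addNr col_mx0; set a := - _; rewrite mul1mx => Xi0.
have /eqP : col_mx (row_mx T1 T2 *m col_mx a b + g) (col_mx a b) = 0.
  apply/eqP; apply: contraTT isT => /Xipos.
  by rewrite Xi0 dot0r ltxx.
rewrite !col_mx_eq0 => /andP [/eqP Y0 /andP [/eqP a0 /eqP b0]].
by move: Y0; rewrite a0 b0 col_mx0 mulmx0 add0r => ->; rewrite col_mx0.
Qed.

Lemma completion_U_block_unit : completion_U \in unitmx -> T2 - T1 *m S2 \in unitmx.
Proof. by rewrite !unitmxE det_ublock unitrM => /andP []. Qed.

End Construction.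

(** The upper right block of the product is [e^T] times that of [J], so only invertibility of the
    leading block matters. *)
Lemma trmx_ublock_mul_tri (R : realType) p1 p2 q1 q2
    (e : 'M[R]_p1) (f : 'M[R]_(p1, p2)) (h : 'M[R]_p2) (J : 'M[R]_(p1 + p2, q1 + q2)) :
  e \in unitmx ->
  lower_block_tri ((block_mx e f 0 h)^T *m J) -> lower_block_tri J.
Proof.
move=> e_unit; rewrite /lower_block_tri ursubmx_mul tr_block_mx trmx0.
rewrite block_mxKul block_mxKur mul0mx addr0 => eJ0.
by rewrite -[LHS](mulKmx (_ : e^T \in unitmx)) ?unitmx_tr // eJ0 mulmx0.
Qed.

Section FactorsOfMultiplier.
Variables (R : realType) (d c1 c2 : nat) (Xi : 'M[R]_(d + (c1 + c2))).
Hypothesis Xis : Xi^T = Xi.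

(** [c] eliminates the last block row of [Xi] on [I; 0; c]. Symmetry of [H] follows from H = J^T Xi
    J with J = [I; 0; c]. *)
Lemma extract_schur : drsubmx (drsubmx Xi) \in unitmx ->
  exists H g c, H^T = H /\ Xi *m col_mx 1%:M (col_mx 0 c) = col_mx H (col_mx g 0).
Proof.
set D := drsubmx (drsubmx Xi) => D_unit.
pose c := - (invmx D *m dsubmx (dlsubmx Xi)).
pose J : 'M_(d + (c1 + c2), d) := col_mx 1%:M (col_mx 0 c).
pose H := usubmx (Xi *m J); pose g := usubmx (dsubmx (Xi *m J)).
have JE : Xi *m J = col_mx H (col_mx g 0).
  rewrite -[LHS]vsubmxK; congr col_mx; rewrite -[LHS]vsubmxK; congr col_mx.
  rewrite /J -{1}[Xi]submxK mul_block_col !mulmx1 col_mxKd -{1}[dlsubmx Xi]vsubmxK.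
  rewrite -{1}[drsubmx Xi]submxK mul_block_col !mulmx0 !add0r add_col_mx col_mxKd.
  by rewrite -/D /c mulmxN mulKVmx // subrr.
exists H, g, c; split=> //.
have -> : H = J^T *m Xi *m J.
  rewrite -mulmxA JE /J !tr_col_mx trmx1 !mul_row_col mulmx0 addr0 trmx0 mul0mx.
  by rewrite mul1mx addr0.
by rewrite !trmx_mul trmxK Xis mulmxA.
Qed.

Lemma extract_inverse : Xi \in unitmx ->
  exists T1 a b, T1^T = T1 /\ Xi *m col_mx T1 (col_mx a b) = col_mx 1%:M 0.
Proof.
move=> Xi_unit; pose I1 : 'M[R]_(d + (c1 + c2), d) := col_mx 1%:M 0.
pose Z := invmx Xi *m I1.
exists (usubmx Z), (usubmx (dsubmx Z)), (dsubmx (dsubmx Z)); split; last first.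
  by rewrite !vsubmxK mulKVmx.
have -> : usubmx Z = I1^T *m invmx Xi *m I1.
  rewrite -mulmxA -/Z -{2}[Z]vsubmxK tr_col_mx trmx1 trmx0.
  by rewrite mul_row_col mul0mx mul1mx addr0.
by rewrite !trmx_mul trmxK trmx_inv Xis mulmxA.
Qed.

Variables (T1 S3 H T2 : 'M[R]_d) (g : 'M[R]_(c1, d)) (c : 'M[R]_(c2, d)).
Variables (a e : 'M[R]_(c1, d)) (b f : 'M[R]_(c2, d)).
Hypothesis T1E : Xi *m col_mx T1 (col_mx a b) = col_mx 1%:M 0.
Hypothesis HE : Xi *m col_mx 1%:M (col_mx 0 c) = col_mx H (col_mx g 0).
Hypothesis S3E : Xi *m col_mx 1%:M 0 = col_mx S3 (col_mx e f).

Let expand (u v w : 'cV[R]_d) :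
  col_mx (row_mx T1 T2 *m col_mx u v + w)
         (block_mx a 0 b (c *m T2) *m col_mx u v) =
  col_mx T1 (col_mx a b) *m u + col_mx 1%:M (col_mx 0 c) *m (T2 *m v)
  + col_mx 1%:M 0 *m w.
Proof.
rewrite !(mul_row_col, mul_block_col, mul_col_mx, add_col_mx).
by rewrite !mul1mx !mul0mx !addr0 mulmxA.
Qed.

(** The columns of [calY] are [T1; a; b], [I; 0; c] T2 and [I; 0; 0]. The zero inside the second
    makes [V] lower triangular, and the zero inside its image makes [U] upper triangular. *)
Lemma extract_congruence :
  congruence Xi (row_mx (H *m T2) S3) (row_mx T1 T2)
    (block_mx (g *m T2) e 0 f) (block_mx a 0 b (c *m T2)).
Proof.
move=> u v w; rewrite expand !mulmxDr !mulmxA T1E HE S3E.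
rewrite !(mul_row_col, mul_block_col, mul_col_mx, add_col_mx).
by rewrite !mul0mx !mul1mx !add0r add_col_mx add0r -!mulmxA addrA.
Qed.

Lemma extract_quad (u v w : 'cV[R]_d) : T1^T = T1 ->
  let x := col_mx (row_mx T1 T2 *m col_mx u v + w)
                  (block_mx a 0 b (c *m T2) *m col_mx u v) in
  let y := col_mx (col_mx u v) w in
  dot x (Xi *m x) = dot y (coupling_mx (H *m T2) S3 T1 T2 *m y).
Proof.
move=> T1s x y; rewrite /x expand coupling_quad.
set x1 := _ *m u; set x2 := _ *m (T2 *m v); set x3 := _ *m w.
have y1 : Xi *m x1 = col_mx u 0.
  by rewrite mulmxA T1E mul_col_mx mul1mx mul0mx.
have y2 : Xi *m x2 = col_mx (H *m T2 *m v) (col_mx (g *m T2 *m v) 0).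
  by rewrite mulmxA HE !mul_col_mx mul0mx !mulmxA.
have y3 : Xi *m x3 = col_mx (S3 *m w) (col_mx e f *m w).
  by rewrite mulmxA S3E !mul_col_mx.
have sw p q : dot p (Xi *m q) = dot q (Xi *m p) by rewrite dotC dot_mull Xis.
have d1 z z' : dot x2 (col_mx z (col_mx z' 0)) = dot (T2 *m v) z.
  by rewrite /x2 !mul_col_mx mul1mx !dot_col mul0mx dot0l dot0r !addr0.
have d3 z z' : dot x3 (col_mx z z') = dot w z.
  by rewrite /x3 mul_col_mx mul1mx !dot_col mul0mx dot0l addr0.
rewrite !mulmxDr !dotDl !dotDr (sw x1 x2) (sw x1 x3) (sw x2 x3) y1 y2 y3.
rewrite !d3 !d1 -[in X in dot x2 X](col_mx0 _ c1 c2) d1.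
rewrite {1}/x1 mul_col_mx dot_col dot0r addr0 !dot_mull T1s !mulmxA trmx_mul.
have -> : dot v (T2^T *m u) = dot u (T2 *m v) by rewrite [RHS]dotC dot_mull.
have -> : dot v (T2^T *m H^T *m w) = dot w (H *m T2 *m v).
  by rewrite [RHS]dotC dot_mull trmx_mul.
by rewrite (dotC w u).
Qed.

End FactorsOfMultiplier.

(* The column blocks [S2] and [T2] of the Lyapunov and multiplier variables   *)
(* parametrize, via [S2 = H T2], the symmetric [H] with invertible lower right *)
(* block.                                                                     *)
Lemma triangular_factorization (R : realType) a b (H : 'M[R]_(a + b)) :
  H^T = H -> drsubmx H \in unitmx ->
  exists (S : 'M_a) (T : 'M_b) (W : 'M_(b, a)),
    [/\ S^T = S, T^T = T, T \in unitmx &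
        H *m block_mx 1%:M 0 (- W) T = block_mx S W^T 0 1%:M].
Proof.
move=> Hs D_unit; pose D := drsubmx H; pose W := invmx D *m dlsubmx H.
have Ds : D^T = D by rewrite /D trmx_drsub Hs.
have WE : W^T = ursubmx H *m invmx D.
  by rewrite /W trmx_mul trmx_dlsub Hs trmx_inv Ds.
exists (ulsubmx H - ursubmx H *m W), (invmx D), W; split.
- rewrite linearB /= trmx_mul WE trmx_ulsub trmx_ursub Hs /W; congr (_ - _).
  by rewrite mulmxA.
- by rewrite trmx_inv Ds.
- by rewrite unitmx_inv.
- rewrite -{1}[H]submxK mulmx_block !mulmx0 !mulmx1 !add0r !mulmxN WE.
  by rewrite -/D mulmxV // mulKVmx // subrr.
Qed.

(** The terms with [W] cancel, and the product is diag(S, T). *)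
Lemma triangular_product_sym (R : realType) a b (S : 'M[R]_a) (T : 'M[R]_b)
    (W : 'M[R]_(b, a)) : S^T = S -> T^T = T ->
  let P := (block_mx 1%:M 0 (- W) T)^T *m block_mx S W^T 0 1%:M in P^T = P.
Proof.
move=> Ss Ts /=; rewrite tr_block_mx trmx1 trmx0 linearN /= mulmx_block.
rewrite !mul1mx !mulmx1 !mulmx0 !mul0mx !addr0 !add0r subrr tr_block_mx !trmx0.
by rewrite Ss Ts Ts.
Qed.

Lemma triangular_unit (R : realType) a b (T : 'M[R]_b) (W : 'M[R]_(b, a)) :
  T \in unitmx -> block_mx 1%:M 0 (- W) T \in unitmx.
Proof. by rewrite !unitmxE det_lblock det1 mul1r. Qed.

(** * Scaling conditions as Lyapunov inequalities *)

Section Scaling.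
Variables (R : realType) (r s : nat) (D : 'M[R]_(r + s)).
Variables (E1 : 'M[R]_(r + s, r)) (E2 : 'M[R]_(r + s, s)).
Hypotheses (DE1 : D *m E1 = - E1) (DE2 : D *m E2 = E2).
Hypothesis E12_unit : row_mx E1 E2 \in unitmx.

(* [D] acts as -1 on the columns of [E1] and as +1 on those of [E2], so the   *)
(* cross terms of [P D + D^T P] in the basis [E1, E2] vanish.                 *)
Lemma scalingP (P : 'M[R]_(r + s)) : P^T = P ->
  (negdef (E1^T *m P *m E1) /\ posdef (E2^T *m P *m E2)) <->
  (forall x, x != 0 -> 0 < dot (P *m x) (D *m x)).
Proof.
move=> Ps.
have E12 (x1 : 'cV_r) (x2 : 'cV_s) :
  E1 *m x1 + E2 *m x2 = row_mx E1 E2 *m col_mx x1 x2 by rewrite mul_row_col.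
have E12_0 (x1 : 'cV_r) (x2 : 'cV_s) : E1 *m x1 + E2 *m x2 = 0 -> x1 = 0 /\ x2 = 0.
  rewrite E12 => /(congr1 (mulmx (invmx (row_mx E1 E2)))); rewrite mulKmx // mulmx0.
  by move/eqP; rewrite col_mx_eq0 => /andP [/eqP -> /eqP ->].
have quadD x1 x2 : let x := E1 *m x1 + E2 *m x2 in
    dot (P *m x) (D *m x) =
    - dot x1 (E1^T *m P *m E1 *m x1) + dot x2 (E2^T *m P *m E2 *m x2).
  rewrite /= !mulmxDr !mulmxA DE1 DE2 mulNmx !dotDl !dotDr !dotNr.
  have -> : dot (P *m E2 *m x2) (E1 *m x1) = dot (P *m E1 *m x1) (E2 *m x2).
    by rewrite [RHS]dotC !dot_mull !trmx_mul Ps !mulmxA.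
  rewrite [dot (P *m E1 *m x1) (E1 *m x1)]dotC [dot (P *m E2 *m x2) (E2 *m x2)]dotC.
  by rewrite !dot_mull !mulmxA; ring.
split=> [[/negdefP [_ N1] /posdefP [_ P2]] x|PD].
  rewrite -(mulKVmx E12_unit x); set y := invmx _ *m x.
  rewrite -[y]vsubmxK -E12 quadD => x0.
  have [u0|/N1 u0] := eqVneq (usubmx y) 0; last first.
    have [->|/P2] := eqVneq (dsubmx y) 0; rewrite ?dot0l; lra.
  rewrite u0 dot0l oppr0 add0r; apply: P2; apply: contraNN x0 => /eqP ->.
  by rewrite u0 !mulmx0 addr0.
split; [apply/negdefP | apply/posdefP]; split; rewrite ?trmx_mul ?trmxK ?Ps ?mulmxA //.
- move=> x x0; have := quadD x 0; rewrite mulmx0 addr0 dot0l addr0 /= => e.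
  have := PD (E1 *m x); rewrite e oppr_gt0; apply.
  apply: contraNN x0 => /eqP E1x; have [|-> //] := E12_0 x 0.
  by rewrite mulmx0 addr0.
- move=> x x0; have := quadD 0 x; rewrite mulmx0 add0r dot0l oppr0 add0r /= => e.
  have := PD (E2 *m x); rewrite e; apply.
  apply: contraNN x0 => /eqP E2x; have [|_ -> //] := E12_0 0 x.
  by rewrite mulmx0 add0r.
Qed.

End Scaling.

Section DeltaScaling.
Variables (R : realType) (rD sD : nat) (V : 'M[R]_(rD, sD) -> Prop).
Hypothesis V0 : V 0.
Local Notation l := ((rD + rD) + (sD + sD))%N.

(** [scalingP] for the eigenspaces [I; 0] and [Delta; I] of [Delta_l]. [V0] supplies a parameter at
    which to read off the condition that does not involve Delta. *)
Lemma primal_scalingP (P : 'M[R]_l) : P^T = P ->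
  primal_scaling V P <->
  (forall Delta, V Delta -> forall x, x != 0 -> 0 < dot (P *m x) (Delta_l Delta *m x)).
Proof.
move=> Ps.
pose E1 : 'M[R]_(l, rD + rD) := col_mx 1%:M 0.
pose E2 Delta : 'M[R]_(l, sD + sD) := col_mx (hat_Delta Delta) 1%:M.
have S Delta := @scalingP R _ _ (Delta_l Delta) E1 (E2 Delta) _ _ _ P Ps.
have DE1 Delta : Delta_l Delta *m E1 = - E1.
  by rewrite mul_block_col !mulmx0 !addr0 mulmx1 mul0mx -[0 in LHS]oppr0 -opp_col_mx.
have DE2 Delta : Delta_l Delta *m E2 Delta = E2 Delta.
  rewrite mul_block_col mul0mx !mulmx1 add0r mulNmx mul1mx scaler_nat mulr2n.
  by rewrite addKr.
have E12 Delta : row_mx E1 (E2 Delta) \in unitmx.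
  by rewrite unitmxE -block_mxEh det_ublock !det1 mulr1 unitr1.
split=> [[_ N1 P2] Delta VD|PD].
  by apply/S => //; split; [exact: N1 | exact: P2].
split; first exact/symmetricP.
- by have /S [//|//|//|N1 _] := PD _ V0.
- by move=> Delta VD; have /S [//|//|//|_ P2] := PD _ VD.
Qed.

(** The transpose of [Delta_l] acts as -1 on [I; -Delta^T] and as +1 on [0; I]. *)
Lemma dual_scalingP (Q : 'M[R]_l) : Q^T = Q ->
  dual_scaling V Q <->
  (forall Delta, V Delta -> forall x, x != 0 -> 0 < dot x (Delta_l Delta *m (Q *m x))).
Proof.
move=> Qs.
pose E1 Delta : 'M[R]_(l, rD + rD) := col_mx 1%:M (- (hat_Delta Delta)^T).
pose E2 : 'M[R]_(l, sD + sD) := col_mx 0 1%:M.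
have S Delta := @scalingP R _ _ (Delta_l Delta)^T (E1 Delta) E2 _ _ _ Q Qs.
have DE1 Delta : (Delta_l Delta)^T *m E1 Delta = - E1 Delta.
  rewrite tr_block_mx linearN linearZ /= !trmx1 trmx0 mul_block_col opp_col_mx.
  rewrite !mul0mx addr0 !mulmx1 mul1mx opprK; congr col_mx.
  by rewrite scaler_nat mulr2n addrK.
have DE2 Delta : (Delta_l Delta)^T *m E2 = E2.
  by rewrite tr_block_mx !trmx1 trmx0 mul_block_col !mulmx0 mul0mx !add0r mulmx1.
have E12 Delta : row_mx (E1 Delta) E2 \in unitmx.
  by rewrite unitmxE -block_mxEh det_lblock !det1 mulr1 unitr1.
have dE Delta x : dot x (Delta_l Delta *m (Q *m x)) = dot (Q *m x) ((Delta_l Delta)^T *m x).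
  by rewrite [RHS]dotC dot_mull trmxK.
split=> [[_ P2 N1] Delta VD|QD].
  have /S QD : negdef ((E1 Delta)^T *m Q *m E1 Delta) /\ posdef (E2^T *m Q *m E2).
    by split; [exact: N1 | exact: P2].
  by move=> x x0; rewrite dE; apply: QD.
have QD' Delta : V Delta -> forall x, x != 0 -> 0 < dot (Q *m x) ((Delta_l Delta)^T *m x).
  by move=> VD x x0; rewrite -dE; apply: QD.
split; first exact/symmetricP.
- by have /S [//|//|//|_ P2] := QD' _ V0.
- by move=> Delta VD; have /S [//|//|//|N1 _] := QD' _ VD.
Qed.

End DeltaScaling.

(** * Perturbation *)

(** The product of both determinants is a polynomial in t that does not vanish at t = 0, so it has
    finitely many roots. *)
Lemma pencil_unit (R : realType) n (A1 B1 A2 B2 : 'M[R]_n) (eps : R) :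
  A1 \in unitmx -> A2 \in unitmx -> 0 < eps ->
  exists s, [/\ 0 < s, s <= eps, A1 - (1 + s) *: B1 \in unitmx
                & A2 - (1 + s) *: B2 \in unitmx].
Proof.
move=> A1u A2u eps0.
pose pen (A B : 'M[R]_n) : {poly R} := \det (map_mx polyC A - 'X *: map_mx polyC B).
have penE A B t : (pen A B).[t] = \det (A - t *: B).
  rewrite -horner_evalE -det_map_mx; congr (\det _).
  by apply/matrixP => i j; rewrite !mxE /= /horner_eval !hornerE.
pose p := pen A1 B1 * pen A2 B2.
have p0 : p != 0.
  apply/eqP => /(congr1 (horner^~ 0)); rewrite hornerM !penE horner0 !scale0r !subr0.
  move/eqP; rewrite mulf_eq0.
  by move: A1u A2u; rewrite !unitmxE !unitfE => /negPf-> /negPf->.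
(* Infinitely many distinct candidates in (1, 1 + eps]; as many as [size p] of them cannot all be
   roots. *)
pose f (k : nat) : R := 1 + eps / k.+1%:R.
have f_inj : injective f.
  move=> i j /addrI /(mulfI (lt0r_neq0 eps0)) /invr_inj /eqP.
  by rewrite eqr_nat eqSS => /eqP.
have : ~~ all (root p) (map f (iota 0 (size p))).
  apply/negP => rootp; have := max_poly_roots p0 rootp.
  by rewrite (map_inj_uniq f_inj) iota_uniq size_map size_iota ltnn => /(_ isT).
case/allPn => _ /mapP [k _ ->]; rewrite rootE hornerM !penE mulf_eq0 negb_or.
rewrite -!unitfE -!unitmxE => /andP [u1 u2].
exists (eps / k.+1%:R); split=> //; first by rewrite divr_gt0 // ltr0Sn.
by rewrite ler_pdivrMr ?ltr0Sn // ler_peMr ?ler1n // ltW.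
Qed.

Lemma castmxD (R : pzRingType) m m' n n' (e : (m = m') * (n = n')) (A B : 'M[R]_(m, n)) :
  castmx e (A + B) = castmx e A + castmx e B.
Proof. by case: e => e1 e2; case: _ / e1; case: _ / e2; rewrite !castmx_id. Qed.

Lemma castmxZ (R : pzRingType) m m' n n' (e : (m = m') * (n = n')) a (A : 'M[R]_(m, n)) :
  castmx e (a *: A) = a *: castmx e A.
Proof. by case: e => e1 e2; case: _ / e1; case: _ / e2; rewrite !castmx_id. Qed.

(** [outer_factor] contains constant identity blocks; subtracting its value at 0 leaves the linear
    part. *)
Lemma outer_factor_affine (R : realType) p q mp kp s
    (G11 D11 : 'M[R]_(p + kp, p + mp)) (G12 D12 : 'M[R]_(p + kp, q + mp))
    (G21 D21 : 'M[R]_(q + kp, p + mp)) (G22 D22 : 'M[R]_(q + kp, q + mp)) :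
  outer_factor (G11 + s *: D11) (G12 + s *: D12) (G21 + s *: D21) (G22 + s *: D22) =
  outer_factor G11 G12 G21 G22
  + s *: (outer_factor D11 D12 D21 D22 - outer_factor 0 0 0 0).
Proof.
rewrite /outer_factor !linearD !linearZ /= !linear0 /=.
rewrite !(opp_col_mx, opp_row_mx, add_col_mx, add_row_mx, scale_col_mx, scale_row_mx).
by rewrite !(scalerN, subrr, oppr0, subr0, scaler0, addr0).
Qed.

Section SynthesisBlockAffine.
Variables (R : realType) (di dj m1 m2 k1 k2 mp kp : nat).
Variables (A : 'M[R]_(di, dj)) (Bp : 'M[R]_(di, mp)) (B : 'M[R]_(di, m1 + m2)).
Variables (Cp : 'M[R]_(kp, dj)) (C : 'M[R]_(k1 + k2, dj)).
Variables (Dp : 'M[R]_(kp, mp)) (E : 'M[R]_(kp, m1 + m2)) (F : 'M[R]_(k1 + k2, mp)).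
Variables (S2 S3 S3' : 'M[R]_di) (T1 T2 T1' : 'M[R]_dj).
Variables (sK : 'M[R]_(di + di, dj + dj)) (sL : 'M[R]_(di + di, k1 + k2)).
Variables (sM : 'M[R]_(m1 + m2, dj + dj)) (sN : 'M[R]_(m1 + m2, k1 + k2)).

(** The corner depends on [S2] and [T2] only. Hence [K_of] does not change with [S3] and [T1], and
    the synthesis block is affine in these two. *)
Lemma upper_part_XAY (S : 'M[R]_di) (T : 'M[R]_dj) :
  upper_part ((row_mx S2 S)^T *m A *m row_mx T T2) =
  block_mx 0 (S2^T *m A *m T2) 0 0.
Proof.
by rewrite /upper_part tr_row_mx mul_col_mx mul_col_row block_mxKur.
Qed.

Definition synthesis_direction : 'M[R]_((di + di + di) + kp, (dj + dj + dj) + mp) :=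
  castmx (congr1 (addn^~ kp) (addnA di di di), erefl)
    (block_mx (block_mx (A *m row_mx T1' 0) 0 0 ((row_mx 0 S3')^T *m A))
              (col_mx 0 ((row_mx 0 S3')^T *m Bp)) (row_mx (Cp *m row_mx T1' 0) 0) 0).

Lemma synthesis_block_affine s :
  synthesis_block A Bp B Cp C Dp E F (row_mx S2 (S3 + s *: S3'))
    (row_mx (T1 + s *: T1') T2) sK sL sM sN =
  synthesis_block A Bp B Cp C Dp E F (row_mx S2 S3) (row_mx T1 T2) sK sL sM sN
  + s *: synthesis_direction.
Proof.
rewrite /synthesis_block /synthesis_direction -castmxZ -castmxD; congr castmx.
rewrite /K_of !upper_part_XAY [RHS]addrAC; congr (_ + _).
have -> : row_mx S2 (S3 + s *: S3') = row_mx S2 S3 + s *: row_mx 0 S3'.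
  by rewrite scale_row_mx scaler0 add_row_mx addr0.
have -> : row_mx (T1 + s *: T1') T2 = row_mx T1 T2 + s *: row_mx T1' 0.
  by rewrite scale_row_mx scaler0 add_row_mx addr0.
rewrite !scale_block_mx add_block_mx.
have -> : (row_mx S2 S3 + s *: row_mx 0 S3')^T = (row_mx S2 S3)^T + s *: (row_mx 0 S3')^T.
  by rewrite linearD linearZ.
rewrite !mulmxDr !mulmxDl -!scalemxAr -!scalemxAl.
rewrite add_block_mx scale_col_mx add_col_mx scale_row_mx add_row_mx.
by rewrite !scaler0 !addr0.
Qed.

End SynthesisBlockAffine.

Section SynthesisOpen.
Variables (R : realType) (d1 d2 m1 m2 k1 k2 mp kp : nat) (gamma : R).
Local Notation m := (m1 + m2)%N.
Local Notation k := (k1 + k2)%N.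
Variables (A11 : 'M[R]_(d1, d1)) (A12 : 'M[R]_(d1, d2)).
Variables (A21 : 'M[R]_(d2, d1)) (A22 : 'M[R]_(d2, d2)).
Variables (Bp1 : 'M[R]_(d1, mp)) (Bp2 : 'M[R]_(d2, mp)).
Variables (B1 : 'M[R]_(d1, m)) (B2 : 'M[R]_(d2, m)).
Variables (Cp1 : 'M[R]_(kp, d1)) (Cp2 : 'M[R]_(kp, d2)).
Variables (C1 : 'M[R]_(k, d1)) (C2 : 'M[R]_(k, d2)).
Variables (Dp : 'M[R]_(kp, mp)) (E : 'M[R]_(kp, m)) (F : 'M[R]_(k, mp)).
Variables (S2 S3 S3' T1 T1' T2 : 'M[R]_d1) (P2 P3 P3' Q1 Q1' Q2 : 'M[R]_d2).
Variables (sK11 : 'M[R]_(d1 + d1, d1 + d1)) (sK12 : 'M[R]_(d1 + d1, d2 + d2)).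
Variables (sK21 : 'M[R]_(d2 + d2, d1 + d1)) (sK22 : 'M[R]_(d2 + d2, d2 + d2)).
Variables (sL1 : 'M[R]_(d1 + d1, k)) (sL2 : 'M[R]_(d2 + d2, k)).
Variables (sM1 : 'M[R]_(m, d1 + d1)) (sM2 : 'M[R]_(m, d2 + d2)) (sN : 'M[R]_(m, k)).

Let form S3 T1 P3 Q1 :=
  let X1 := row_mx S2 S3 in let Y1 := row_mx T1 T2 in
  let X2 := row_mx P2 P3 in let Y2 := row_mx Q1 Q2 in
  performance_form gamma 1%:M 1%:M
    (synthesis_block A11 Bp1 B1 Cp1 C1 Dp E F X1 Y1 sK11 sL1 sM1 sN)
    (synthesis_block A12 Bp1 B1 Cp2 C2 Dp E F X1 Y2 sK12 sL1 sM2 sN)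
    (synthesis_block A21 Bp2 B2 Cp1 C1 Dp E F X2 Y1 sK21 sL2 sM1 sN)
    (synthesis_block A22 Bp2 B2 Cp2 C2 Dp E F X2 Y2 sK22 sL2 sM2 sN).

Lemma synthesis_open : negdef (form S3 T1 P3 Q1) ->
  exists2 eps, 0 < eps & forall s, `|s| <= eps ->
    negdef (form (S3 + s *: S3') (T1 + s *: T1') (P3 + s *: P3') (Q1 + s *: Q1')).
Proof.
rewrite /form /performance_form.
move/(@negdef_open _ _ _ _ _
  (outer_factor (synthesis_direction A11 Bp1 Cp1 S3' T1')
                (synthesis_direction A12 Bp1 Cp2 S3' Q1')
                (synthesis_direction A21 Bp2 Cp1 P3' T1')
                (synthesis_direction A22 Bp2 Cp2 P3' Q1') - outer_factor 0 0 0 0)).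
case=> [|eps eps0 H]; first by apply: performance_weight_sym; rewrite trmx1.
exists eps => // s /H.
by rewrite !synthesis_block_affine outer_factor_affine.
Qed.

End SynthesisOpen.

(** * Structure of the variables *)

Section LyapunovStructure.
Variables (R : realType) (n1 n2 : nat) (Y : lyapunov_vars R n1 n2).

(** The last columns of a triangular [B] vanish in their upper part, and the transpose of [S2] fixes
    vectors [0; v]. *)
Lemma S2_rsubmx m1 m2 (B : 'M[R]_(n1 + n2, m1 + m2)) :
  lower_block_tri B -> (S2 Y)^T *m rsubmx B = rsubmx B.
Proof.
move=> B_tri; have -> : rsubmx B = col_mx 0 (drsubmx B).
  by rewrite -{1}[B]submxK block_mxEh row_mxKr B_tri.
rewrite /S2 tr_block_mx trmx0 trmx1 mul_block_col !mulmx0 mul0mx mul1mx.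
by rewrite !add0r.
Qed.

Lemma usubmx_T2 k1 k2 (C : 'M[R]_(k1 + k2, n1 + n2)) :
  lower_block_tri C -> usubmx C *m T2 Y = usubmx C.
Proof.
move=> C_tri; have -> : usubmx C = row_mx (ulsubmx C) 0.
  by rewrite -{1}[C]submxK col_mxKu C_tri.
by rewrite /T2 mul_row_block !mul0mx mulmx1 mulmx0 !addr0.
Qed.

Lemma T2_S2_sym : ((T2 Y)^T *m S2 Y)^T = (T2 Y)^T *m S2 Y.
Proof.
apply: (triangular_product_sym (W Y)); apply/symmetricP;
  [exact: S22_sym | exact: T22_sym].
Qed.

End LyapunovStructure.

(** The permutation taking the order (r1, s1, r2, s2) to (r1, r2, s1, s2). In the former order [P2]
    and [Q2] have the shape of [S2] and [T2], and [Delta_l] is block diagonal with two equal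
    blocks. *)
Definition shuffle (R : realType) r s : 'M[R]_((r + r) + (s + s), (r + s) + (r + s)) :=
  block_mx (block_mx 1%:M 0 0 0) (block_mx 0 0 1%:M 0)
           (block_mx 0 1%:M 0 0) (block_mx 0 0 0 1%:M).

Section Shuffle.
Variables (R : realType) (rD sD : nat).
Local Notation Pi := (shuffle R rD sD).

Lemma tr_shuffle_mul : Pi^T *m Pi = 1%:M.
Proof.
rewrite /shuffle !tr_block_mx !trmx0 !trmx1 mulmx_block !mulmx_block.
rewrite !(mul0mx, mulmx0, mul1mx, addr0, add0r) !add_block_mx.
rewrite !(addr0, add0r) block_mx0 [RHS](scalar_mx_block (rD + sD) (rD + sD) 1).
by rewrite (scalar_mx_block rD sD 1).
Qed.

Lemma shuffle_mul_tr : Pi *m Pi^T = 1%:M.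
Proof.
rewrite /shuffle !tr_block_mx !trmx0 !trmx1 mulmx_block !mulmx_block.
rewrite !(mul0mx, mulmx0, mul1mx, addr0, add0r) !add_block_mx.
rewrite !(addr0, add0r) !block_mx0 [RHS](scalar_mx_block (rD + rD) (sD + sD) 1).
by rewrite (scalar_mx_block rD rD 1) (scalar_mx_block sD sD 1).
Qed.

Lemma shuffle_conj (A B C D : 'M[R]_(rD + sD)) :
  Pi *m block_mx A B C D *m Pi^T =
  block_mx
    (block_mx (ulsubmx A) (ulsubmx B) (ulsubmx C) (ulsubmx D))
    (block_mx (ursubmx A) (ursubmx B) (ursubmx C) (ursubmx D))
    (block_mx (dlsubmx A) (dlsubmx B) (dlsubmx C) (dlsubmx D))
    (block_mx (drsubmx A) (drsubmx B) (drsubmx C) (drsubmx D)).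
Proof.
rewrite -{1}[A]submxK -{1}[B]submxK -{1}[C]submxK -{1}[D]submxK.
rewrite /shuffle !tr_block_mx !trmx0 !trmx1.
rewrite mulmx_block !mulmx_block !add_block_mx.
rewrite !(mul0mx, mulmx0, mul1mx, addr0, add0r).
rewrite mulmx_block !mulmx_block !add_block_mx.
by rewrite !(mul0mx, mulmx0, mulmx1, addr0, add0r).
Qed.

Lemma Delta_l_shuffle (Delta : 'M[R]_(rD, sD)) :
  let delta := block_mx (- 1%:M) (2%:R *: Delta) 0 1%:M in
  Delta_l Delta = Pi *m block_mx delta 0 0 delta *m Pi^T.
Proof.
rewrite /= shuffle_conj !(block_mxKul, block_mxKur, block_mxKdl, block_mxKdr).
rewrite !(linear0 (@ulsubmx R _ _ _ _), linear0 (@ursubmx R _ _ _ _),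
  linear0 (@dlsubmx R _ _ _ _), linear0 (@drsubmx R _ _ _ _)) /Delta_l /hat_Delta.
rewrite block_mx0 -scalar_mx_block scale_block_mx !scaler0 [in LHS](scalar_mx_block rD rD 1).
by rewrite opp_block_mx !oppr0.
Qed.

Variables (V : 'M[R]_(rD, sD) -> Prop) (Z : multiplier_vars V).

Lemma P2_shuffle : P2 Z = Pi *m block_mx (Pm Z) (Rm Z)^T 0 1%:M *m Pi^T.
Proof.
rewrite shuffle_conj (scalar_mx_block rD sD 1).
rewrite !(block_mxKul, block_mxKur, block_mxKdl, block_mxKdr).
rewrite -trmx_ulsub -trmx_dlsub -trmx_ursub -trmx_drsub.
by rewrite !linear0.
Qed.

Lemma Q2_shuffle : Q2 Z = Pi *m block_mx 1%:M 0 (- Rm Z) (Qm Z) *m Pi^T.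
Proof.
rewrite shuffle_conj (scalar_mx_block rD sD 1).
rewrite !(block_mxKul, block_mxKur, block_mxKdl, block_mxKdr).
by rewrite !linearN !linear0.
Qed.

Lemma Q2_P2_sym : ((Q2 Z)^T *m P2 Z)^T = (Q2 Z)^T *m P2 Z.
Proof.
have -> : (Q2 Z)^T *m P2 Z = Pi *m ((block_mx 1%:M 0 (- Rm Z) (Qm Z))^T
    *m block_mx (Pm Z) (Rm Z)^T 0 1%:M) *m Pi^T.
  rewrite Q2_shuffle P2_shuffle !trmx_mul trmxK -!mulmxA.
  by rewrite (mulmxA Pi^T Pi) tr_shuffle_mul mul1mx.
rewrite 2!trmx_mul trmxK mulmxA; congr (_ *m _ *m _).
apply: (triangular_product_sym (Rm Z)); apply/symmetricP;
  [exact: Pm_sym | exact: Qm_sym].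
Qed.

Lemma P2_rsubmx m1 m2 (B : 'M[R]_(sD + sD, m1 + m2)) : lower_block_tri B ->
  (P2 Z)^T *m rsubmx (col_mx 0 B : 'M[R]_((rD + rD) + (sD + sD), m1 + m2)) =
  rsubmx (col_mx 0 B).
Proof.
move=> B_tri.
have -> : rsubmx (col_mx 0 B : 'M[R]_((rD + rD) + (sD + sD), m1 + m2)) =
    col_mx 0 (col_mx 0 (drsubmx B)).
  rewrite -{1}[B]submxK B_tri block_mxEh -{1}(row_mx0 _ _ m1 m2).
  by rewrite -[col_mx (row_mx _ _) _]/(block_mx _ _ _ _) block_mxEh row_mxKr.
rewrite /P2 !tr_block_mx !trmx0 !trmx1 !mul_block_col.
by rewrite !(mul0mx, mulmx0, mul1mx, addr0, add0r) !col_mx0.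
Qed.

Lemma usubmx_Q2 k1 k2 (C : 'M[R]_(k1 + k2, rD + rD)) : lower_block_tri C ->
  usubmx (row_mx C 0 : 'M[R]_(k1 + k2, (rD + rD) + (sD + sD))) *m Q2 Z =
  usubmx (row_mx C 0).
Proof.
move=> C_tri.
have -> : usubmx (row_mx C 0 : 'M[R]_(k1 + k2, (rD + rD) + (sD + sD))) =
    row_mx (row_mx (ulsubmx C) 0) 0.
  rewrite -{1}[C]submxK C_tri -{1}(col_mx0 _ k1 k2 (sD + sD)).
  by rewrite -block_mxEh col_mxKu.
rewrite /Q2 !mul_row_block.
by rewrite !(mul0mx, mulmx0, mulmx1, addr0, add0r) !row_mx0.
Qed.

End Shuffle.

(** * From synthesis to analysis *)

Section ControllerReconstruction.
Variables (R : realType) (di dj m1 m2 k1 k2 : nat).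
Variables (A : 'M[R]_(di, dj)) (B : 'M[R]_(di, m1 + m2)) (C : 'M[R]_(k1 + k2, dj)).
Variables (S2 S3 : 'M[R]_di) (T1 T2 : 'M[R]_dj).
Local Notation X := (row_mx S2 S3).
Local Notation Y := (row_mx T1 T2).
Variables (sK : 'M[R]_(di + di, dj + dj)) (sL : 'M[R]_(di + di, k1 + k2)).
Variables (sM : 'M[R]_(m1 + m2, dj + dj)) (N : 'M[R]_(m1 + m2, k1 + k2)).
Variables (e f h : 'M[R]_di).
Local Notation U := (block_mx e f 0 h).
Hypothesis S2B : S2^T *m rsubmx B = rsubmx B.
Hypothesis CT2 : usubmx C *m T2 = usubmx C.
Hypothesis N_tri : lower_block_tri N.
Hypothesis sL_tri : lower_block_tri sL.
Hypothesis sM_tri : lower_block_tri sM.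
Hypothesis sK_tri : lower_block_tri sK.
Hypothesis U_unit : U \in unitmx.

Let e_unit : e \in unitmx.
Proof. by move: U_unit; rewrite !unitmxE det_ublock unitrM => /andP []. Qed.

(** Solve for [Bc] by inverting U^T. The right-hand side is triangular by [ursubmx_L], and division
    by U^T keeps it so. *)
Lemma controller_B : exists2 Bc, lower_block_tri Bc &
  L_of B sL N = U^T *m Bc + X^T *m B *m N.
Proof.
pose Bc := L_of B sL N - X^T *m B *m N.
have BcE : U^T *m (invmx U^T *m Bc) = Bc by rewrite mulKVmx // unitmx_tr.
exists (invmx U^T *m Bc); last by rewrite BcE subrK.
apply: (trmx_ublock_mul_tri (f := f) (h := h) e_unit); rewrite BcE /lower_block_tri.
by rewrite (ursubmx_L (S3 := S3) (sL := sL) S2B N_tri) // /Bc subrK.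
Qed.

Lemma controller_C : exists2 Cc, lower_block_tri Cc &
  M_of C sM N = Cc *m 1%:M + N *m C *m Y.
Proof.
pose Cc := M_of C sM N - N *m C *m Y.
exists Cc; last by rewrite mulmx1 subrK.
by rewrite /lower_block_tri (ursubmx_M (T1 := T1) (sM := sM) CT2 N_tri) // /Cc subrK.
Qed.

Lemma controller_A Bc Cc :
  L_of B sL N = U^T *m Bc + X^T *m B *m N ->
  M_of C sM N = Cc *m 1%:M + N *m C *m Y ->
  exists2 Ac, lower_block_tri Ac &
  K_of A B C X Y sK sL sM N =
    U^T *m Ac *m 1%:M + X^T *m B *m (Cc *m 1%:M) + U^T *m Bc *m C *m Y
    + X^T *m B *m N *m C *m Y + X^T *m A *m Y.
Proof.
rewrite mulmx1 => LE ME.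
pose Z := X^T *m B *m Cc + U^T *m Bc *m C *m Y + X^T *m B *m N *m C *m Y + X^T *m A *m Y.
pose Ac := K_of A B C X Y sK sL sM N - Z.
have AcE : U^T *m (invmx U^T *m Ac) = Ac by rewrite mulKVmx // unitmx_tr.
have KE : K_of A B C X Y sK sL sM N = Ac + X^T *m B *m Cc + U^T *m Bc *m C *m Y
    + X^T *m B *m N *m C *m Y + X^T *m A *m Y.
  by rewrite -[LHS](subrK Z) -/Ac /Z !addrA.
exists (invmx U^T *m Ac); last by rewrite mulmx1 AcE.
apply: (trmx_ublock_mul_tri (f := f) (h := h) e_unit); rewrite AcE /lower_block_tri.
by rewrite (ursubmx_K S2B CT2 N_tri LE ME KE).
Qed.

End ControllerReconstruction.

Lemma affine_onP (R : realType) p q a b (V : 'M[R]_(p, q) -> Prop)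
    (f : 'M[R]_(p, q) -> 'M[R]_(a, b)) :
  linear (fun D => f D - f 0) -> affine_on V f.
Proof.
move=> f_lin.
pose g D := f D - f 0.
pose L : {linear 'M[R]_(p, q) -> 'M[R]_(a, b)} :=
  HB.pack g (GRing.isLinear.Build R _ _ *:%R g f_lin).
by exists (f 0), L => D _; rewrite /= /g addrC subrK.
Qed.

Section Schedule.
Variables (R : realType) (l : nat) (P2 P3 Q1 Q2 : 'M[R]_l).
Implicit Types D : 'M[R]_l.

(* Chosen so that [sched_inner D] cancels the off-diagonal blocks of the      *)
(* transformed scaling inequality.                                            *)
Definition sched_inner D : 'M[R]_(l + l) :=
  block_mx (- (P2^T *m D *m Q1 + Q2^T *m D^T)) 0
    (- (P3 *m D *m Q1 + D^T)) (- (P3 *m D *m Q2 + D^T *m P2)).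

(** The scaling form of the extended multiplier at [calY] [a; b; g]: only the dual, coupling and
    primal terms survive. *)
Lemma sched_inner_quad D (a b g : 'cV[R]_l) : P3^T = P3 -> Q1^T = Q1 ->
  dot (a + row_mx P2 P3 *m col_mx b g) (D *m (row_mx Q1 Q2 *m col_mx a b + g))
  + dot (col_mx b g) (sched_inner D *m col_mx a b) =
  dot a (D *m (Q1 *m a)) + dot b (P2^T *m D *m Q2 *m b) + dot (P3 *m g) (D *m g).
Proof.
move=> P3s Q1s; rewrite !(mul_row_col, mul_block_col) dot_col mul0mx addr0.
rewrite !(mulNmx, mulmxDl, mulmxDr, dotNr, dotDl, dotDr, dot_mull, mulmxA) P3s.
have -> : dot b (Q2^T *m D^T *m a) = dot a (D *m Q2 *m b).
  by rewrite [RHS]dotC dot_mull trmx_mul.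
have -> : dot g (D^T *m a) = dot a (D *m g) by rewrite [RHS]dotC dot_mull.
have -> : dot g (D^T *m P2 *m b) = dot b (P2^T *m D *m g).
  by rewrite [RHS]dotC dot_mull trmx_mul trmxK.
ring.
Qed.

End Schedule.

Lemma sched_inner_linear (R : realType) l (P2 P3 Q1 Q2 : 'M[R]_l) :
  linear (sched_inner P2 P3 Q1 Q2).
Proof.
move=> a x y; rewrite /sched_inner scale_block_mx add_block_mx.
rewrite scaler0 addr0; have -> : (a *: x + y)^T = a *: x^T + y^T by rewrite linearP.
congr block_mx; apply/matrixP => i j;
  rewrite !(mulmxDr, mulmxDl) -?scalemxAr -?scalemxAl !mxE; ring.
Qed.

Lemma Delta_l_affine (R : realType) rD sD a (x y : 'M[R]_(rD, sD)) :
  Delta_l (a *: x + y) = a *: (Delta_l x - Delta_l 0) + Delta_l y.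
Proof.
apply/matrixP => i j; rewrite /Delta_l /hat_Delta !mxE.
case: (split i) => {}i; rewrite !mxE; case: (split j) => {}j; rewrite !mxE;
  rewrite ?subrr ?mulr0 ?add0r //.
by case: (split i) => {}i; rewrite !mxE; case: (split j) => {}j; rewrite !mxE; ring.
Qed.

Lemma affine_sched (R : realType) rD sD (V : 'M[R]_(rD, sD) -> Prop)
    (P2 P3 Q1 Q2 : 'M[R]_((rD + rD) + (sD + sD)))
    (W : 'M[R]_((rD + rD) + (sD + sD) + ((rD + rD) + (sD + sD)))) :
  affine_on V (fun Delta => W *m sched_inner P2 P3 Q1 Q2 (Delta_l Delta)).
Proof.
apply: affine_onP => a x y.
rewrite Delta_l_affine sched_inner_linear.
have -> : sched_inner P2 P3 Q1 Q2 (Delta_l x - Delta_l 0) =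
    sched_inner P2 P3 Q1 Q2 (Delta_l x) - sched_inner P2 P3 Q1 Q2 (Delta_l 0).
  by rewrite -scaleN1r addrC sched_inner_linear scaleN1r addrC.
by rewrite mulmxDr -scalemxAr mulmxBr addrA.
Qed.

Lemma multiplier_formP (R : realType) p (D P : 'M[R]_p) : P^T = P ->
  posdef ((col_mx D 1%:M)^T *m anti_diag P *m col_mx D 1%:M) <->
  forall x, x != 0 -> 0 < dot (P *m x) (D *m x).
Proof.
move=> Ps; have quad x : dot x ((col_mx D 1%:M)^T *m anti_diag P *m col_mx D 1%:M *m x)
    = dot (P *m x) (D *m x) *+ 2.
  rewrite -!mulmxA -dot_mull !mul_col_mx mul1mx !mul_row_col !mul0mx add0r addr0.
  by rewrite dot_col dotC (dot_mull P) Ps mulr2n.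
split=> [/posdefP [_ PD] x /PD|PD]; first by rewrite quad pmulrn_lgt0.
apply/posdefP; split=> [|x /PD PDx]; last by rewrite quad pmulrn_lgt0.
by rewrite !trmx_mul trmxK tr_block_mx !trmx0 Ps mulmxA.
Qed.

Section Sufficiency.
Variables (R : realType) (n1 n2 m1 m2 k1 k2 rD sD mp kp : nat).
Variables (V : 'M[R]_(rD, sD) -> Prop) (V0 : V 0) (gamma : R).
Variable G : plant R n1 n2 m1 m2 k1 k2 rD sD mp kp.
Local Notation n := (n1 + n2)%N.
Local Notation l := ((rD + rD) + (sD + sD))%N.

Lemma primal_scalingZ t (P : 'M[R]_l) : 0 < t ->
  primal_scaling V P -> primal_scaling V (t *: P).
Proof.
move=> t0 PV; have Ps : P^T = P by case: PV => /symmetricP.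
move/(primal_scalingP V0 Ps) in PV; apply/(primal_scalingP V0).
  by rewrite linearZ /= Ps.
by move=> D /PV PD x /PD; rewrite -scalemxAl dotZl => ?; rewrite mulr_gt0.
Qed.

Lemma dual_scalingZ t (Q : 'M[R]_l) : 0 < t ->
  dual_scaling V Q -> dual_scaling V (t *: Q).
Proof.
move=> t0 QV; have Qs : Q^T = Q by case: QV => /symmetricP.
move/(dual_scalingP V0 Qs) in QV; apply/(dual_scalingP V0).
  by rewrite linearZ /= Qs.
by move=> D /QV QD x /QD; rewrite -scalemxAl -scalemxAr dotZr => ?; rewrite mulr_gt0.
Qed.

Lemma coupling_dot (Z : multiplier_vars V) : coupling_lmi Z ->
  forall D, V D -> forall x, x != 0 ->
    0 < dot x ((P2 Z)^T *m Delta_l D *m Q2 Z *m x).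
Proof.
move=> HZ D /HZ /posdefP [_ HD] x /HD; rewrite mulmxDl dotDr.
by rewrite [X in _ + X]dotC dot_mull trmxK -mulr2n pmulrn_lgt0.
Qed.

(** At Delta = 0 the product P2^T Delta_l Q2 has positive definite symmetric part, so it is
    invertible, and so are its outer factors. *)
Lemma coupling_unit (Z : multiplier_vars V) : coupling_lmi Z ->
  P2 Z \in unitmx /\ Q2 Z \in unitmx.
Proof.
move=> /coupling_dot /(_ 0 V0) HZ.
have : (P2 Z)^T *m Delta_l 0 *m Q2 Z \in unitmx.
  apply: unitmx_inj => x x0; apply/eqP; apply: contraTT isT => /HZ.
  by rewrite x0 dot0r ltxx.
by rewrite !unitmx_mul unitmx_tr => /andP [/andP [-> _] ->].
Qed.

(* Scaling [P3] and [Q1] by a common factor close to 1 makes the diagonal     *)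
(* blocks of [completion_U] invertible and keeps the strict inequalities.     *)
Lemma multiplier_generic Y (Z : multiplier_vars V) U :
  synthesis_lmi gamma G Y Z U -> coupling_lmi Z ->
  exists Z' : multiplier_vars V,
    [/\ synthesis_lmi gamma G Y Z' U, coupling_lmi Z' &
        completion_U (P2 Z') (P3 Z') (Q1 Z') (Q2 Z') \in unitmx].
Proof.
move=> lmi HZ; have [P2u Q2u] := coupling_unit HZ.
have [eps eps0 openH] := synthesis_open 0 0 (P3 Z) (Q1 Z) lmi.
have P2tu : (P2 Z)^T \in unitmx by rewrite unitmx_tr.
have [s [s0 les u1 u2]] := pencil_unit (Q1 Z *m P2 Z) ((Q2 Z)^T *m P3 Z) Q2u P2tu eps0.
have s1 : 0 < 1 + s by rewrite addr_gt0.
pose Z' := MultiplierVars (Rm Z) (primal_scalingZ s1 (P3_scaling Z))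
  (dual_scalingZ s1 (Q1_scaling Z)) (Pm_sym Z) (Qm_sym Z).
have P3E : P3 Z + s *: P3 Z = P3 Z' by rewrite /= scalerDl scale1r.
have Q1E : Q1 Z + s *: Q1 Z = Q1 Z' by rewrite /= scalerDl scale1r.
have P2E : P2 Z = P2 Z' by [].
have Q2E : Q2 Z = Q2 Z' by [].
exists Z'; split; last 1 first.
- rewrite unitmxE det_ublock unitrM -!unitmxE /=.
  by rewrite -scalemxAl u1 -scalemxAr u2.
- move: (openH s); rewrite ger0_norm; last exact: ltW.
  by move=> /(_ les); rewrite !scaler0 !addr0 P3E Q1E P2E Q2E; apply.
- by rewrite /coupling_lmi -P2E -Q2E; exact: HZ.
Qed.


(** Every controller matrix, and the scheduling function as well, comes from solving the
    transformation formulas with [V = I]. The controller has the dimensions of [U], twice those of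
    the plant channels. *)
Lemma sufficiency Y (Z : multiplier_vars V) U :
  synthesis_lmi gamma G Y Z U -> posdef (bbX Y) -> coupling_lmi Z ->
  exists (nc1 nc2 lc1 lc2 : nat)
         (K : controller m1 m2 k1 k2 V nc1 nc2 lc1 lc2 lc1 lc2)
         (X : 'M[R]_(n + (nc1 + nc2))) (P : 'M[R]_(l + (lc1 + lc2))),
    [/\ [/\ posdef X, full_multiplier K P & analysis_lmi gamma G K X P],
        affine_on V (csched K), (nc1 + nc2 <= 2 * n)%N & (lc1 + lc2 <= 2 * l)%N].
Proof.
move=> lmi0 X_pos HZ0.
have {Z lmi0 HZ0} [Z [lmi HZ U2_unit]] := multiplier_generic lmi0 HZ0.
have S3s := elimT (symmetricP _) (S3_sym Y); have T1s := elimT (symmetricP _) (T1_sym Y).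
have P3s : (P3 Z)^T = P3 Z by case: (P3_scaling Z) => /symmetricP.
have Q1s : (Q1 Z)^T = Q1 Z by case: (Q1_scaling Z) => /symmetricP.
have T2S2s := T2_S2_sym Y; have Q2P2s := Q2_P2_sym Z.
have U1_unit := completion_U_unit S3s T1s T2S2s X_pos.
have Xi1_pos := completion_mx_posdef S3s T1s T2S2s X_pos.
have Xi1s := completion_mx_sym S3s T1s T2S2s; have Xi2s := completion_mx_sym P3s Q1s Q2P2s.
have cong1 := completion_mx_congruence (S3 Y) (T1 Y) T2S2s.
have cong2 := completion_mx_congruence (P3 Z) (Q1 Z) Q2P2s.
have SB1 : (S2 Y)^T *m rsubmx (lB1 G) = rsubmx (lB1 G) by exact (S2_rsubmx Y (hB1_tri G)).
have CT1 : usubmx (lC1 G) *m T2 Y = usubmx (lC1 G) by exact (usubmx_T2 Y (hC1_tri G)).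
have SB2 : (P2 Z)^T *m rsubmx (lB2 G) = rsubmx (lB2 G).
  have B_tri : lower_block_tri (2%:R *: hB2 G).
    by rewrite /lower_block_tri linearZ /= hB2_tri scaler0.
  exact (P2_rsubmx Z B_tri).
have CT2 : usubmx (lC2 G) *m Q2 Z = usubmx (lC2 G) by exact (usubmx_Q2 Z (hC2_tri G)).
have Ntri := sN_tri U.
have [Bc1 Bc1_tri L1E] := controller_B (S3 Y) SB1 Ntri (sL1_tri U) U1_unit.
have [Bc2 Bc2_tri L2E] := controller_B (P3 Z) SB2 Ntri (sL2_tri U) U2_unit.
have [Cc1 Cc1_tri M1E] := controller_C (T1 Y) CT1 Ntri (sM1_tri U).
have [Cc2 Cc2_tri M2E] := controller_C (Q1 Z) CT2 Ntri (sM2_tri U).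
have [Ac11 Ac11_tri K11E] := controller_A (lA11 G) SB1 CT1 Ntri
  (sL1_tri U) (sM1_tri U) (sK11_tri U) U1_unit L1E M1E.
have [Ac12 Ac12_tri K12E] := controller_A (lA12 G) SB1 CT2 Ntri
  (sL1_tri U) (sM2_tri U) (sK12_tri U) U1_unit L1E M2E.
have [Ac21 Ac21_tri K21E] := controller_A (lA21 G) SB2 CT1 Ntri
  (sL2_tri U) (sM1_tri U) (sK21_tri U) U2_unit L2E M1E.
have [Ac22 Ac22_tri K22E] := controller_A (lA22 G) SB2 CT2 Ntri
  (sL2_tri U) (sM2_tri U) (sK22_tri U) U2_unit L2E M2E.
set U2 := block_mx _ _ 0 _ in L2E K21E K22E U2_unit.
have U2T_unit : U2^T \in unitmx by rewrite unitmx_tr.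
pose sched Delta :=
  invmx U2^T *m sched_inner (P2 Z) (P3 Z) (Q1 Z) (Q2 Z) (Delta_l Delta).
have schedE Delta : U2^T *m sched Delta =
    sched_inner (P2 Z) (P3 Z) (Q1 Z) (Q2 Z) (Delta_l Delta) by rewrite mulKVmx.
have sched_tri Delta : V Delta -> lower_block_tri (sched Delta).
  move=> _; apply: (trmx_ublock_mul_tri (f := 1%:M - Q1 Z *m P3 Z)
     (h := (P2 Z)^T - (Q2 Z)^T *m P3 Z) (completion_U_block_unit U2_unit)).
  by rewrite -/U2 schedE /lower_block_tri block_mxKur.
exists n, n, l, l, (Controller Ac11_tri Ac12_tri Ac21_tri Ac22_tri Bc1_tri Bc2_tri
  Cc1_tri Cc2_tri Ntri sched_tri).
exists (completion_mx (S2 Y) (S3 Y) (T1 Y) (T2 Y)).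
exists (completion_mx (P2 Z) (P3 Z) (Q1 Z) (Q2 Z)).
split; [split | exact: affine_sched | by rewrite mul2n addnn | by rewrite mul2n addnn] => //.
- split; first exact/symmetricP.
  move=> Delta VD; apply/multiplier_formP; first exact: Xi2s.
  move=> x; have [a [b [g xE]]] := completion_split (Q1 Z) (Q2 Z) x.
  rewrite xE cong2 mul1mx /Delta_lc [block_mx (Delta_l _) _ _ _ *m _]mul_block_col.
  rewrite !mul0mx addr0 add0r dot_col -[completion_U _ _ _ _]/U2 => x0.
  rewrite (dot_mull U2) [U2^T *m _]mulmxA schedE sched_inner_quad //.
  have qa c : c != 0 -> 0 < dot c (Delta_l Delta *m (Q1 Z *m c)).
    exact: (iffLR (dual_scalingP V0 Q1s) (Q1_scaling Z) Delta VD).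
  have qb c := coupling_dot HZ VD (x := c).
  have qg c : c != 0 -> 0 < dot (P3 Z *m c) (Delta_l Delta *m c).
    exact: (iffLR (primal_scalingP V0 P3s) (P3_scaling Z) Delta VD).
  have a0 : 0 <= dot a (Delta_l Delta *m (Q1 Z *m a)).
    by have [->|/qa/ltW//] := eqVneq a 0; rewrite dot0l.
  have b0 : 0 <= dot b ((P2 Z)^T *m Delta_l Delta *m Q2 Z *m b).
    by have [->|/qb/ltW//] := eqVneq b 0; rewrite dot0l.
  have g0 : 0 <= dot (P3 Z *m g) (Delta_l Delta *m g).
    by have [->|/qg/ltW//] := eqVneq g 0; rewrite !mulmx0 dot0l.
  (* The three terms are nonnegative, and each is positive unless its vector vanishes. *)
  have [az|/qa] := eqVneq a 0; last by lra.
  have [bz|/qb] := eqVneq b 0; last by lra.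
  have [gz|/qg] := eqVneq g 0; last by lra.
  by rewrite az bz gz !col_mx0 mulmx0 addr0 col_mx0 eqxx in x0.
- apply/negdefP; split; first exact: performance_form_sym.
  move=> x; rewrite -[x]vsubmxK; move: (usubmx x) (dsubmx x) => {x} x w.
  rewrite -[x]vsubmxK; move: (usubmx x) (dsubmx x) => {x} x1 x2.
  have [a1 [b1 [g1 ->]]] := completion_split (T1 Y) (T2 Y) x1.
  have [a2 [b2 [g2 ->]]] := completion_split (Q1 Z) (Q2 Z) x2.
  move=> x0.
  have <- := synthesis_closed_loop_quad gamma (lB1p G) (lB2p G) (lC1p G) (lC2p G)
    (lDp G) (lE G) (lF G) Xi1s Xi2s cong1 cong2 L1E L2E M1E M2E K11E K12E K21E K22E
    a1 b1 g1 a2 b2 g2 w.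
  move/negdefP: lmi => [_]; apply; apply: contraNN x0.
  rewrite !col_mx_eq0 => /andP [/andP [/andP [/andP [/eqP -> /eqP ->] /eqP ->]]].
  move=> /andP [/andP [/eqP -> /eqP ->] /eqP ->] /eqP ->.
  by rewrite !col_mx0 !mulmx0 !addr0 !eqxx.
Qed.

End Sufficiency.

(** * From analysis to synthesis *)

Section ControllerVariables.
Variables (R : realType) (di dj m1 m2 k1 k2 : nat).
Variables (A : 'M[R]_(di, dj)) (B : 'M[R]_(di, m1 + m2)) (C : 'M[R]_(k1 + k2, dj)).
Variables (S2 S3 : 'M[R]_di) (T1 T2 : 'M[R]_dj).
Local Notation X := (row_mx S2 S3).
Local Notation Y := (row_mx T1 T2).
Variables (N : 'M[R]_(m1 + m2, k1 + k2)).
Variables (Ac : 'M[R]_(di + di, dj + dj)) (Bc : 'M[R]_(di + di, k1 + k2)).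
Variables (Cc : 'M[R]_(m1 + m2, dj + dj)).
Hypothesis S2B : S2^T *m rsubmx B = rsubmx B.
Hypothesis CT2 : usubmx C *m T2 = usubmx C.
Hypothesis N_tri : lower_block_tri N.
Hypothesis Ac_tri : lower_block_tri Ac.
Hypothesis Bc_tri : lower_block_tri Bc.
Hypothesis Cc_tri : lower_block_tri Cc.

Lemma synthesis_L : exists2 sL, lower_block_tri sL &
  L_of B sL N = Bc + X^T *m B *m N.
Proof.
pose sL := Bc + X^T *m B *m N - upper_part (ext_B B *m N).
have LE : L_of B sL N = Bc + X^T *m B *m N by rewrite /L_of subrK.
by exists sL => //; rewrite /lower_block_tri -(ursubmx_L S2B N_tri LE).
Qed.

Lemma synthesis_M : exists2 sM, lower_block_tri sM &
  M_of C sM N = Cc + N *m C *m Y.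
Proof.
pose sM := Cc + N *m C *m Y - upper_part (N *m ext_C C).
have ME : M_of C sM N = Cc + N *m C *m Y by rewrite /M_of subrK.
by exists sM => //; rewrite /lower_block_tri -(ursubmx_M CT2 N_tri ME).
Qed.

(** [K_of] is [sK] plus terms free of [sK], so [sK] is found by subtraction; [ursubmx_K] shows that
    it is triangular. *)
Lemma synthesis_K sL sM : lower_block_tri sL -> lower_block_tri sM ->
  L_of B sL N = Bc + X^T *m B *m N -> M_of C sM N = Cc + N *m C *m Y ->
  exists2 sK, lower_block_tri sK &
  K_of A B C X Y sK sL sM N =
    Ac + X^T *m B *m Cc + Bc *m C *m Y + X^T *m B *m N *m C *m Y + X^T *m A *m Y.
Proof.
move=> sL_tri sM_tri LE ME.
pose Z := K_of A B C X Y 0 sL sM N.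
pose K := Ac + X^T *m B *m Cc + Bc *m C *m Y + X^T *m B *m N *m C *m Y + X^T *m A *m Y.
have KE : K_of A B C X Y (K - Z) sL sM N = K.
  by rewrite -[RHS](subrK Z) /Z /K_of add0r !addrA.
exists (K - Z) => //.
by rewrite /lower_block_tri -(ursubmx_K S2B CT2 N_tri LE ME KE).
Qed.

End ControllerVariables.

Lemma posdef_unit (R : realType) p (M : 'M[R]_p) : posdef M -> M \in unitmx.
Proof.
move=> /posdefP [_ Mx]; apply: unitmx_inj => x x0.
by apply/eqP; apply: contraTT isT => /Mx; rewrite x0 dot0r ltxx.
Qed.

Lemma posdef_addtr (R : realType) p (M : 'M[R]_p) :
  (forall x, x != 0 -> 0 < dot x (M *m x)) -> posdef (M + M^T).
Proof.
move=> Mx; apply/posdefP; split; first by rewrite linearD /= trmxK addrC.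
move=> x x0; rewrite mulmxDl dotDr [X in _ + X]dotC dot_mull trmxK -mulr2n.
by rewrite pmulrn_lgt0 //; apply: Mx.
Qed.

Lemma posdef_drsubmx (R : realType) p q (M : 'M[R]_(p + q)) :
  posdef M -> posdef (drsubmx M).
Proof.
move=> /posdefP [Ms Mx]; apply/posdefP; split; first by rewrite trmx_drsub Ms.
move=> x x0; have := Mx (col_mx 0 x); rewrite -{1}[M]submxK mul_block_col.
rewrite !mulmx0 !add0r dot_col dot0l add0r; apply.
by rewrite col_mx_eq0 negb_and x0 orbT.
Qed.

Lemma mulmx_first_col (R : realType) d c1 c2 (Xi : 'M[R]_(d + (c1 + c2))) :
  Xi *m col_mx 1%:M 0 =
  col_mx (ulsubmx Xi) (col_mx (usubmx (dlsubmx Xi)) (dsubmx (dlsubmx Xi))).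
Proof.
by rewrite -{1}[Xi]submxK mul_block_col !mulmx0 !mulmx1 !addr0 vsubmxK.
Qed.

Section LyapunovExtraction.
Variables (R : realType) (d c1 c2 : nat) (Xi : 'M[R]_(d + (c1 + c2))).
Hypothesis Xi_pos : posdef Xi.
Variables (T1 H : 'M[R]_d) (a g : 'M[R]_(c1, d)) (b c : 'M[R]_(c2, d)).
Hypothesis T1E : Xi *m col_mx T1 (col_mx a b) = col_mx 1%:M 0.
Hypothesis HE : Xi *m col_mx 1%:M (col_mx 0 c) = col_mx H (col_mx g 0).

(** The form of [Xi] at [T1; a; b] x equals the inner product of T1 x and x, so it vanishes when T1
    x = 0. *)
Lemma extract_T1_unit : T1 \in unitmx.
Proof.
have [_ Xix] := iffLR (posdefP _) Xi_pos.
apply: unitmx_inj => x T1x.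
have XiE : Xi *m (col_mx T1 (col_mx a b) *m x) = col_mx x 0.
  by rewrite mulmxA T1E mul_col_mx mul1mx mul0mx.
have [z0|/Xix] := eqVneq (col_mx T1 (col_mx a b) *m x) 0.
  move: XiE; rewrite z0 mulmx0 => /esym/eqP.
  by rewrite col_mx_eq0 => /andP [/eqP].
by rewrite XiE mul_col_mx dot_col T1x dot0l dot0r addr0 ltxx.
Qed.

Lemma extract_H_posdef : H^T = H -> posdef H.
Proof.
move=> Hs; have [_ Xix] := iffLR (posdefP _) Xi_pos.
apply/posdefP; split=> // x x0.
have := Xix (col_mx 1%:M (col_mx 0 c) *m x).
rewrite mulmxA HE !mul_col_mx !mul0mx mul1mx !dot_col dot0l dot0r !addr0; apply.
by rewrite col_mx_eq0 negb_and x0.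
Qed.

End LyapunovExtraction.

Section MultiplierExtraction.
Variables (R : realType) (d c1 c2 : nat) (Xi : 'M[R]_(d + (c1 + c2))).
Variables (D : 'M[R]_d) (Dc : 'M[R]_(c1 + c2)).
Hypothesis Xis : Xi^T = Xi.
Hypothesis Dc_tri : lower_block_tri Dc.
Hypothesis Xi_pos :
  forall x, x != 0 -> 0 < dot (Xi *m x) (block_mx D 0 0 Dc *m x).

Lemma multiplier_unit : Xi \in unitmx.
Proof.
apply: unitmx_inj => x x0.
by apply/eqP; apply: contraTT isT => /Xi_pos; rewrite x0 dot0l ltxx.
Qed.

(** A lower triangular [Dc] keeps [0; 0; x] in the last block, so a kernel vector of that block of
    [Xi] would make the form vanish. [Xi] itself may be indefinite. *)
Lemma multiplier_drsub_unit : drsubmx (drsubmx Xi) \in unitmx.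
Proof.
apply: unitmx_inj => x Xx.
apply/eqP; apply: contraTT isT => x0.
have := Xi_pos (x := col_mx 0 (col_mx 0 x)).
rewrite !col_mx_eq0 !negb_and x0 !orbT => /(_ isT).
rewrite -{1}[Xi]submxK -{1}[drsubmx Xi]submxK -{1}[Dc]submxK Dc_tri.
rewrite !mul_block_col !mulmx0 !mul0mx !add0r Xx.
by rewrite !dot_col !dot0r dot0l !addr0 ltxx.
Qed.

Lemma multiplier_ulsub x : x != 0 -> 0 < dot (ulsubmx Xi *m x) (D *m x).
Proof.
move=> x0; have XiE : Xi *m col_mx x 0 =
    col_mx (ulsubmx Xi *m x) (dlsubmx Xi *m x).
  by rewrite -{1}[Xi]submxK mul_block_col !mulmx0 !addr0.
have := Xi_pos (x := col_mx x 0); rewrite XiE mul_block_col !mulmx0 mul0mx !addr0.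
by rewrite dot_col dot0r addr0; apply; rewrite col_mx_eq0 negb_and x0.
Qed.

Lemma multiplier_T1 (T1 : 'M[R]_d) (a : 'M[R]_(c1, d)) (b : 'M[R]_(c2, d)) x :
  Xi *m col_mx T1 (col_mx a b) = col_mx 1%:M 0 ->
  x != 0 -> 0 < dot x (D *m (T1 *m x)).
Proof.
move=> T1E x0; have XiE : Xi *m (col_mx T1 (col_mx a b) *m x) = col_mx x 0.
  by rewrite mulmxA T1E mul_col_mx mul1mx mul0mx.
have := Xi_pos (x := col_mx T1 (col_mx a b) *m x); rewrite XiE.
rewrite [X in block_mx _ _ _ _ *m X]mul_col_mx mul_block_col.
rewrite mul0mx addr0 dot_col dot0l addr0; apply.
apply: contraNN x0 => /eqP z0; move/esym: XiE.
by rewrite z0 mulmx0 => /eqP; rewrite col_mx_eq0 => /andP [].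
Qed.

(** Test on [x; 0; c x]: [Xi] maps it to a vector with zero last block, while triangular [Dc]
    contributes to the last block only, so the controller part drops out. *)
Lemma multiplier_H (H : 'M[R]_d) (g : 'M[R]_(c1, d)) (c : 'M[R]_(c2, d)) x :
  Xi *m col_mx 1%:M (col_mx 0 c) = col_mx H (col_mx g 0) ->
  x != 0 -> 0 < dot (H *m x) (D *m x).
Proof.
move=> HE x0; have XiE : Xi *m col_mx x (col_mx 0 (c *m x)) =
    col_mx (H *m x) (col_mx (g *m x) 0).
  have <- : col_mx 1%:M (col_mx (0 : 'M_(c1, d)) c) *m x = col_mx x (col_mx 0 (c *m x)).
    by rewrite !mul_col_mx mul1mx mul0mx.
  by rewrite mulmxA HE !mul_col_mx mul0mx.
have := Xi_pos (x := col_mx x (col_mx 0 (c *m x))).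
rewrite XiE mul_block_col !mul0mx addr0 add0r.
rewrite -[Dc]submxK Dc_tri mul_block_col !mulmx0 !mul0mx !add0r.
rewrite !dot_col !dot0r dot0l !addr0; apply.
by rewrite col_mx_eq0 negb_and x0.
Qed.

End MultiplierExtraction.

(* Added to [sK11] or [sK22], it makes the synthesis form negative on the     *)
(* kernel of the congruence, where [T1 a + T2 b + g = 0].                     *)
Definition damping (R : realType) d (T1 T2 : 'M[R]_d) : 'M[R]_(d + d) :=
  block_mx (2%:R *: (T2^T *m T1)) 0 T1 T2.

(** With p = T1 a, q = T2 b and g = y - p - q, the left-hand side is 2 y.(p + q) - 2 |p|^2 - 2
    |q|^2; then 2 y.p <= |y|^2 + |p|^2, and likewise for q. *)
Lemma damping_quad (R : realType) d (T1 T2 : 'M[R]_d) (a b g : 'cV[R]_d) :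
  let y := row_mx T1 T2 *m col_mx a b + g in
  2 * dot (col_mx b g) (damping T1 T2 *m col_mx a b) <=
  2 * dot y y - dot (T1 *m a) (T1 *m a) - dot (T2 *m b) (T2 *m b).
Proof.
rewrite /damping mul_row_col mul_block_col mul0mx addr0 dot_col -scalemxAl dotZr.
rewrite -[T2^T *m T1 *m a]mulmxA -dot_mull.
set p := T1 *m a; set q := T2 *m b; set y := p + q + g.
have -> : g = y - p - q by rewrite /y -addrA -opprD addrC addKr.
have := dot_ge0 (y - p); have := dot_ge0 (y - q).
rewrite !(dotDl, dotDr, dotNl, dotNr) (dotC q p) (dotC g p) (dotC g q); lra.
Qed.

(** [F] is the coercive closed-loop form. The 3 in the choice of [s] lets [F] pay for three copies
    of s |y|^2: two absorb the positive part of the damping, and one is left over. *)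
Lemma damping_margin (R : realType) (s C F y1 y2 z1 z2 w p1 q1 p2 q2 d1 d2 : R) :
  0 < s -> 0 <= C -> 3 * s * (1 + C) = 1 ->
  0 <= y1 -> 0 <= y2 -> 0 <= z1 -> 0 <= z2 -> 0 <= w ->
  0 <= p1 -> 0 <= q1 -> 0 <= p2 -> 0 <= q2 ->
  F <= 0 -> y1 + z1 + (y2 + z2) + w <= - (C * F) ->
  d1 <= 2 * y1 - p1 - q1 -> d2 <= 2 * y2 - p2 - q2 ->
  0 <= F + s * (d1 + d2) ->
  [/\ y1 = 0, y2 = 0, w = 0 & [/\ p1 = 0, q1 = 0, p2 = 0 & q2 = 0]].
Proof.
move=> s0 C0 sC y10 y20 z10 z20 w0 p10 q10 p20 q20 F0 hF h1 h2 tot.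
have e : 3 * s * (1 + C) * F = F by rewrite sC mul1r.
have sF : s * F <= 0 by rewrite pmulr_rle0.
have sd : s * (d1 + d2) <= s * (2 * y1 - p1 - q1 + (2 * y2 - p2 - q2)).
  by rewrite ler_pM2l //; lra.
have sS := ler_wpM2l (ltW s0) hF.
have sz : 0 <= s * (z1 + z2) by rewrite pmulr_rge0 // addr_ge0.
have sw : 0 <= s * w by rewrite pmulr_rge0.
have : s * (y1 + y2 + w + p1 + q1 + p2 + q2) <= 0 by lra.
rewrite pmulr_rle0 // => sum0.
by split; last split; lra.
Qed.

Section Necessity.
Variables (R : realType) (n1 n2 m1 m2 k1 k2 rD sD mp kp : nat).
Variables (V : 'M[R]_(rD, sD) -> Prop) (V0 : V 0) (gamma : R).
Variable G : plant R n1 n2 m1 m2 k1 k2 rD sD mp kp.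
Local Notation n := (n1 + n2)%N.
Local Notation l := ((rD + rD) + (sD + sD))%N.

Lemma shuffle_drsub_unit (H : 'M[R]_l) :
  (forall x, x != 0 -> 0 < dot (H *m x) (Delta_l 0 *m x)) ->
  drsubmx ((shuffle R rD sD)^T *m H *m shuffle R rD sD) \in unitmx.
Proof.
move=> H0; set Pi := shuffle R rD sD; apply: unitmx_inj => x Hx.
apply/eqP; apply: contraTT isT => x0.
have PiPi : Pi^T *m Pi = 1%:M by exact: tr_shuffle_mul.
have Px0 : Pi *m col_mx 0 x != 0.
  apply: contraNN x0 => /eqP /(congr1 (mulmx Pi^T)).
  by rewrite mulmxA PiPi mul1mx mulmx0 => /eqP; rewrite col_mx_eq0 => /andP [].
have := H0 _ Px0; rewrite Delta_l_shuffle -/Pi.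
set delta : 'M[R]_(rD + sD) := block_mx (- 1%:M) _ 0 1%:M.
have -> : Pi *m block_mx delta 0 0 delta *m Pi^T *m (Pi *m col_mx 0 x)
    = Pi *m (block_mx delta 0 0 delta *m col_mx 0 x).
  by rewrite -!mulmxA (mulmxA Pi^T Pi) PiPi mul1mx.
rewrite (dotC _ (Pi *m (_ *m _))) dot_mull !mulmxA.
rewrite -[Pi^T *m H *m Pi]submxK !mul_block_col Hx !mulmx0 !mul0mx !add0r dot_col.
by rewrite dot0l dot0r addr0 ltxx.
Qed.

(** [H] is factored in the order of [shuffle]. From P2 = H Q2 and symmetry of [H], the coupling
    product is Q2^T H Delta_l Q2, a congruence of the assumed inequality. *)
Lemma multiplier_factorization (H P Q : 'M[R]_l) :
  H^T = H -> primal_scaling V P -> dual_scaling V Q ->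
  (forall D, V D -> forall x, x != 0 -> 0 < dot (H *m x) (Delta_l D *m x)) ->
  exists Z : multiplier_vars V, [/\ P3 Z = P, Q1 Z = Q, H *m Q2 Z = P2 Z,
    Q2 Z \in unitmx & coupling_lmi Z].
Proof.
move=> Hs PV QV HV; pose Pi := shuffle R rD sD.
have H'u := shuffle_drsub_unit (HV 0 V0); rewrite -/Pi /= in H'u.
have H's : (Pi^T *m H *m Pi)^T = Pi^T *m H *m Pi.
  by rewrite !trmx_mul trmxK Hs mulmxA.
have [S [T [Wm [Ss Ts Tu SE]]]] := triangular_factorization H's H'u.
pose Z := MultiplierVars Wm PV QV (introT (symmetricP _) Ss) (introT (symmetricP _) Ts).
have HQ : H *m Q2 Z = P2 Z.
  rewrite P2_shuffle Q2_shuffle /= -/Pi -SE !mulmxA.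
  by rewrite shuffle_mul_tr mul1mx.
have Q2u : Q2 Z \in unitmx.
  apply: unitmx_inj => x; rewrite Q2_shuffle /= -/Pi => /(congr1 (mulmx Pi^T)).
  rewrite mulmx0 !mulmxA tr_shuffle_mul mul1mx -mulmxA.
  move=> /(congr1 (mulmx (invmx (block_mx 1%:M 0 (- Wm) T)))).
  rewrite mulKmx ?triangular_unit // mulmx0 => /(congr1 (mulmx Pi)).
  by rewrite mulmxA shuffle_mul_tr mul1mx mulmx0.
exists Z; split=> //; rewrite /coupling_lmi; cbv zeta => Delta VD.
apply: posdef_addtr => x x0.
rewrite -!mulmxA -dot_mull -HQ -mulmxA; apply: HV => //.
by apply: contraNN x0 => /eqP Qx; rewrite -[x](mulKmx Q2u) Qx mulmx0.
Qed.

Lemma lyapunov_factorization (H T3 T : 'M[R]_n) :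
  posdef H -> T3^T = T3 -> T^T = T ->
  exists Y : lyapunov_vars R n1 n2, [/\ S3 Y = T3, T1 Y = T, H *m T2 Y = S2 Y
    & T2 Y \in unitmx].
Proof.
move=> H_pos T3s Ts; have [Hs _] := iffLR (posdefP _) H_pos.
have Du := posdef_unit (posdef_drsubmx H_pos).
have [S [T' [Wm [Ss T's T'u SE]]]] := triangular_factorization Hs Du.
exists (LyapunovVars Wm (introT (symmetricP _) T3s) (introT (symmetricP _) Ts)
  (introT (symmetricP _) Ss) (introT (symmetricP _) T's)); split=> //.
exact: triangular_unit.
Qed.

(* The congruence of [synthesis_closed_loop_quad] need not be injective; the  *)
(* [damping] of [sK11] and [sK22] and the shift of [T1] and [S3] restore      *)
(* strictness.                                                                *)
Lemma necessity nc1 nc2 lc1 lc2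
    (K : controller m1 m2 k1 k2 V nc1 nc2 lc1 lc2 lc1 lc2)
    (X : 'M[R]_(n + (nc1 + nc2))) (P : 'M[R]_(l + (lc1 + lc2))) :
  posdef X -> full_multiplier K P -> analysis_lmi gamma G K X P ->
  exists (Y : lyapunov_vars R n1 n2) (Z : multiplier_vars V)
         (U : controller_vars R n l m1 m2 k1 k2),
    [/\ synthesis_lmi gamma G Y Z U, posdef (bbX Y) & coupling_lmi Z].
Proof.
move=> X_pos [/symmetricP Ps P_mul] lmi.
have [Xs _] := iffLR (posdefP _) X_pos.
have [H1 [g1 [c1 [H1s H1E]]]] :=
  extract_schur Xs (posdef_unit (posdef_drsubmx (posdef_drsubmx X_pos))).
have [T [a1 [b1 [Ts TE]]]] := extract_inverse Xs (posdef_unit X_pos).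
have X3s : (ulsubmx X)^T = ulsubmx X by rewrite trmx_ulsub Xs.
have H1_pos := extract_H_posdef X_pos H1E H1s.
have T_unit := extract_T1_unit X_pos TE.
have [Y [S3E T1E S2E T2u]] := lyapunov_factorization H1_pos X3s Ts.
have {}P_mul D : V D -> forall x, x != 0 ->
    0 < dot (P *m x) (block_mx (Delta_l D) 0 0 (csched K D) *m x).
  by move=> /P_mul /multiplier_formP; apply.
have PV0 := P_mul 0 V0; have sched0 := csched_tri K V0.
have [H2 [g2 [c2 [H2s H2E]]]] := extract_schur Ps (multiplier_drsub_unit sched0 PV0).
have [Q [a2 [b2 [Qs QE]]]] := extract_inverse Ps (multiplier_unit PV0).
have P3s : (ulsubmx P)^T = ulsubmx P by rewrite trmx_ulsub Ps.
have P3V : primal_scaling V (ulsubmx P).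
  apply/(primal_scalingP V0 P3s) => D VD x x0.
  exact: (multiplier_ulsub (P_mul D VD) x0).
have QD D : V D -> forall x, x != 0 -> 0 < dot x (Delta_l D *m (Q *m x)).
  by move=> VD x x0; exact: (multiplier_T1 (P_mul D VD) QE x0).
have QV : dual_scaling V Q by apply/(dual_scalingP V0 Qs).
have HV D : V D -> forall x, x != 0 -> 0 < dot (H2 *m x) (Delta_l D *m x).
  by move=> VD x x0; exact: (multiplier_H (csched_tri K VD) (P_mul D VD) H2E x0).
have Q_unit : Q \in unitmx.
  apply: unitmx_inj => x Qx; apply/eqP; apply: contraTT isT => /(QD 0 V0).
  by rewrite Qx mulmx0 dot0r ltxx.
have [Z [P3E Q1E P2E Q2u HZ]] := multiplier_factorization H2s P3V QV HV.
set e1 := usubmx (dlsubmx X); set f1 := dsubmx (dlsubmx X).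
pose U1 := block_mx (g1 *m T2 Y) e1 0 f1; pose V1 := block_mx a1 0 b1 (c1 *m T2 Y).
set e2 := usubmx (dlsubmx P); set f2 := dsubmx (dlsubmx P).
pose U2 := block_mx (g2 *m Q2 Z) e2 0 f2; pose V2 := block_mx a2 0 b2 (c2 *m Q2 Z).
have cong1 : congruence X (row_mx (S2 Y) (S3 Y)) (row_mx (T1 Y) (T2 Y)) U1 V1.
  by rewrite -S2E S3E T1E; apply: (extract_congruence (T2 Y) TE H1E (mulmx_first_col X)).
have cong2 : congruence P (row_mx (P2 Z) (P3 Z)) (row_mx (Q1 Z) (Q2 Z)) U2 V2.
  by rewrite -P2E P3E Q1E; apply: (extract_congruence (Q2 Z) QE H2E (mulmx_first_col P)).
have U1T_tri : lower_block_tri U1^T.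
  by rewrite /lower_block_tri tr_block_mx block_mxKur trmx0.
have U2T_tri : lower_block_tri U2^T.
  by rewrite /lower_block_tri tr_block_mx block_mxKur trmx0.
have V1_tri : lower_block_tri V1 by rewrite /lower_block_tri block_mxKur.
have V2_tri : lower_block_tri V2 by rewrite /lower_block_tri block_mxKur.
have SB1 : (S2 Y)^T *m rsubmx (lB1 G) = rsubmx (lB1 G) by exact (S2_rsubmx Y (hB1_tri G)).
have CT1 : usubmx (lC1 G) *m T2 Y = usubmx (lC1 G) by exact (usubmx_T2 Y (hC1_tri G)).
have SB2 : (P2 Z)^T *m rsubmx (lB2 G) = rsubmx (lB2 G).
  have B_tri : lower_block_tri (2%:R *: hB2 G).
    by rewrite /lower_block_tri linearZ /= hB2_tri scaler0.
  exact (P2_rsubmx Z B_tri).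
have CT2 : usubmx (lC2 G) *m Q2 Z = usubmx (lC2 G) by exact (usubmx_Q2 Z (hC2_tri G)).
have N_tri := cD_tri K.
have Bc1_tri := lower_block_tri_mul U1T_tri (cB1_tri K).
have Bc2_tri := lower_block_tri_mul U2T_tri (cB2_tri K).
have Cc1_tri := lower_block_tri_mul (cC1_tri K) V1_tri.
have Cc2_tri := lower_block_tri_mul (cC2_tri K) V2_tri.
have Ac11_tri := lower_block_tri_mul (lower_block_tri_mul U1T_tri (cA11_tri K)) V1_tri.
have Ac12_tri := lower_block_tri_mul (lower_block_tri_mul U1T_tri (cA12_tri K)) V2_tri.
have Ac21_tri := lower_block_tri_mul (lower_block_tri_mul U2T_tri (cA21_tri K)) V1_tri.
have Ac22_tri := lower_block_tri_mul (lower_block_tri_mul U2T_tri (cA22_tri K)) V2_tri.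
have [L1 L1_tri L1E] := synthesis_L (S3 Y) SB1 N_tri Bc1_tri.
have [L2 L2_tri L2E] := synthesis_L (P3 Z) SB2 N_tri Bc2_tri.
have [M1 M1_tri M1E] := synthesis_M (T1 Y) CT1 N_tri Cc1_tri.
have [M2 M2_tri M2E] := synthesis_M (Q1 Z) CT2 N_tri Cc2_tri.
have [K11 K11_tri K11E] := synthesis_K (lA11 G) SB1 CT1 N_tri Ac11_tri L1_tri M1_tri L1E M1E.
have [K12 K12_tri K12E] := synthesis_K (lA12 G) SB1 CT2 N_tri Ac12_tri L1_tri M2_tri L1E M2E.
have [K21 K21_tri K21E] := synthesis_K (lA21 G) SB2 CT1 N_tri Ac21_tri L2_tri M1_tri L2E M1E.
have [K22 K22_tri K22E] := synthesis_K (lA22 G) SB2 CT2 N_tri Ac22_tri L2_tri M2_tri L2E M2E.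
have [C C0 HC] := posdef_coercive (iffLR (negdefN _) lmi).
pose s := (3 * (1 + C))^-1.
have s0 : 0 < s by rewrite invr_gt0 mulr_gt0 // ltr_wpDr.
have sC : 3 * s * (1 + C) = 1 by rewrite mulrAC mulfV // gt_eqF // mulr_gt0 // ltr_wpDr.
have damping_tri q (T' T'' : 'M[R]_q) (J : 'M[R]_(q + q)) :
    lower_block_tri J -> lower_block_tri (J + s *: damping T' T'').
  by rewrite /lower_block_tri linearD linearZ /= block_mxKur scaler0 addr0.
pose U := ControllerVars (damping_tri _ (T1 Y) (T2 Y) _ K11_tri) K12_tri K21_tri
  (damping_tri _ (Q1 Z) (Q2 Z) _ K22_tri) L1_tri L2_tri M1_tri M2_tri N_tri.
have lmi' : synthesis_lmi gamma G Y Z U.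
  apply/negdefP; split; first by apply: performance_form_sym; rewrite trmx1.
  move=> v; rewrite -[v]vsubmxK; move: (usubmx v) (dsubmx v) => {v} v w.
  rewrite -[v]vsubmxK; move: (usubmx v) (dsubmx v) => {v} v1 v2.
  rewrite -[v1]vsubmxK -[v2]vsubmxK -[usubmx v1]vsubmxK -[usubmx v2]vsubmxK.
  move: (dsubmx v1) (usubmx (usubmx v1)) (dsubmx (usubmx v1)) => r1 p1 q1.
  move: (dsubmx v2) (usubmx (usubmx v2)) (dsubmx (usubmx v2)) => {v1 v2} r2 p2 q2 v0.
  rewrite [X in X < 0]synthesis_quad_shift.
  rewrite (synthesis_closed_loop_quad gamma (lB1p G) (lB2p G) (lC1p G) (lC2p G)
    (lDp G) (lE G) (lF G) Xs Ps cong1 cong2 L1E L2E M1E M2E K11E K12E K21E K22E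
    p1 q1 r1 p2 q2 r2 w).
  set y1 := _ *m col_mx p1 q1 + r1; set y2 := _ *m col_mx p2 q2 + r2.
  set z1 := V1 *m _; set z2 := V2 *m _.
  have := damping_quad (T1 Y) (T2 Y) p1 q1 r1; rewrite /= -/y1.
  have := damping_quad (Q1 Z) (Q2 Z) p2 q2 r2; rewrite /= -/y2.
  set x := col_mx (col_mx (col_mx y1 z1) (col_mx y2 z2)) w.
  have F0 : dot x (performance_form gamma X P (cl11 G K) (cl12 G K)
      (cl21 G K) (cl22 G K) *m x) <= 0.
    have [->|x0] := eqVneq x 0; first by rewrite dot0l.
    by have [_ neg] := iffLR (negdefP _) lmi; apply/ltW/neg.
  have := HC x; rewrite mulNmx dotNr mulrN {1 2}/x !dot_col => hF h2 h1.
  (* A nonnegative value would force y, w, T1 a and T2 b to vanish in both channels, hence [v = 0]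
     by invertibility. *)
  rewrite ltNge; apply/negP => tot.
  have [y10 y20 w0 [p10 q10 p20 q20]] := damping_margin s0 C0 sC (dot_ge0 y1) (dot_ge0 y2)
    (dot_ge0 z1) (dot_ge0 z2) (dot_ge0 w) (dot_ge0 _) (dot_ge0 _) (dot_ge0 _) (dot_ge0 _)
    F0 hF h1 h2 tot.
  have dot0 q (t : 'cV[R]_q) : dot t t = 0 -> t = 0 by move/eqP; rewrite dot_eq0 => /eqP.
  have inj0 q (M : 'M[R]_q) (t : 'cV[R]_q) :
      M \in unitmx -> dot (M *m t) (M *m t) = 0 -> t = 0.
    by move=> Mu /dot0 Mt; rewrite -[t](mulKmx Mu) Mt mulmx0.
  have T1u : T1 Y \in unitmx by rewrite T1E.
  have Q1u : Q1 Z \in unitmx by rewrite Q1E.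
  move: (inj0 _ _ _ T1u p10) (inj0 _ _ _ T2u q10) (inj0 _ _ _ Q1u p20) (inj0 _ _ _ Q2u q20).
  move=> {}p10 {}q10 {}p20 {}q20; move: (dot0 _ _ y10) (dot0 _ _ y20) (dot0 _ _ w0).
  rewrite /y1 /y2 p10 q10 p20 q20 !col_mx0 !mulmx0 !add0r => r10 r20 {}w0.
  by rewrite p10 q10 p20 q20 w0 r10 r20 !col_mx0 eqxx in v0.
(* So far the congruence gives only a nonnegative [bbX]. Adding eps I to [S3] and [T1] adds eps
   (|a|^2 + |g|^2) to its form, and the synthesis inequality survives for small eps. *)
have [eps eps0 openH] := synthesis_open 1%:M 1%:M 0 0 lmi'.
have shift_sym (M : 'M[R]_n) : M \is symmetricmx -> M + eps *: 1%:M \is symmetricmx.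
  by move=> /symmetricP Ms; apply/symmetricP; rewrite linearD linearZ /= trmx1 Ms.
pose Y' := LyapunovVars (W Y) (shift_sym _ (S3_sym Y)) (shift_sym _ (T1_sym Y))
  (S22_sym Y) (T22_sym Y).
exists Y', Z, U; split; last exact: HZ.
  have S2Y : S2 Y = S2 Y' by []. have T2Y : T2 Y = T2 Y' by [].
  have := openH eps; rewrite ger0_norm; last exact: ltW.
  by move=> /(_ (lexx _)); rewrite !scaler0 !addr0 S2Y T2Y; apply.
apply/posdefP; split.
  apply: (@coupling_mx_sym _ _ (S2 Y') (S3 Y') (T1 Y') (T2 Y')); [| |exact: T2_S2_sym].
  - exact: (elimT (symmetricP _) (S3_sym Y')).
  - exact: (elimT (symmetricP _) (T1_sym Y')).
move=> v; rewrite -[v]vsubmxK -[usubmx v]vsubmxK.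
move: (usubmx (usubmx v)) (dsubmx (usubmx v)) (dsubmx v) => {v} a b g v0.
have -> : dot (col_mx (col_mx a b) g) (bbX Y' *m col_mx (col_mx a b) g) =
    dot (col_mx (col_mx a b) g) (bbX Y *m col_mx (col_mx a b) g)
    + eps * (dot a a + dot g g).
  rewrite [bbX Y']/(coupling_mx (S2 Y) (S3 Y') (T1 Y') (T2 Y)).
  rewrite [bbX Y]/(coupling_mx (S2 Y) (S3 Y) (T1 Y) (T2 Y)) !coupling_quad /=.
  rewrite !mulmxDl -!scalemxAl !mul1mx !dotDr !dotZr; ring.
have := extract_quad Xs (T2 Y) TE H1E (mulmx_first_col X) a b g Ts.
rewrite S2E -S3E -T1E /= => quadE.
have [_ Xpos] := iffLR (posdefP _) X_pos.
set x := col_mx (_ + g) _ in quadE.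
rewrite [bbX Y]/(coupling_mx (S2 Y) (S3 Y) (T1 Y) (T2 Y)) -quadE.
have x_ge0 : 0 <= dot x (X *m x).
  by have [->|/Xpos/ltW//] := eqVneq x 0; rewrite dot0l.
have a_ge0 := dot_ge0 a; have g_ge0 := dot_ge0 g.
have [ag0|ag0] := eqVneq (dot a a + dot g g) 0; last first.
  by rewrite ltr_wpDl // mulr_gt0 // lt_def ag0 addr_ge0.
have /andP [/eqP a0 /eqP g0] : (a == 0) && (g == 0).
  by rewrite -!dot_eq0 -paddr_eq0 // ag0.
(* For a = g = 0 the first component of [x] is T2 b, which is nonzero unless b = 0. *)
rewrite ag0 mulr0 addr0; apply: Xpos; apply: contraNN v0.
rewrite /x a0 g0 mul_row_col mulmx0 add0r addr0 col_mx_eq0 => /andP [/eqP Tb _].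
by rewrite -[b](mulKmx T2u) Tb mulmx0 !col_mx0.
Qed.

End Necessity.

Theorem theorem6 (R : realType) (n1 n2 m1 m2 k1 k2 rD sD mp kp : nat)
    (N : nat) (vertex : 'I_N -> 'M[R]_(rD, sD))
    (V0 : conv_hull vertex 0)
    (G : plant R n1 n2 m1 m2 k1 k2 rD sD mp kp)
    (gamma : R) (gamma_gt0 : 0 < gamma) :
  let V := conv_hull vertex in
  let n := (n1 + n2)%N in
  let l := ((rD + rD) + (sD + sD))%N in
  ((exists (nc1 nc2 lc1 lc2 : nat)
           (K : controller m1 m2 k1 k2 V nc1 nc2 lc1 lc2 lc1 lc2)
           (X : 'M[R]_(n + (nc1 + nc2))) (P : 'M[R]_(l + (lc1 + lc2))),
      [/\ posdef X, full_multiplier K P & analysis_lmi gamma G K X P])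
   <->
   (exists (Y : lyapunov_vars R n1 n2) (Z : multiplier_vars V)
           (U : controller_vars R n l m1 m2 k1 k2),
      [/\ synthesis_lmi gamma G Y Z U, posdef (bbX Y) & coupling_lmi Z]))
  /\
  ((exists (Y : lyapunov_vars R n1 n2) (Z : multiplier_vars V)
           (U : controller_vars R n l m1 m2 k1 k2),
      [/\ synthesis_lmi gamma G Y Z U, posdef (bbX Y) & coupling_lmi Z])
   ->
   (exists (nc1 nc2 lc1 lc2 : nat)
           (K : controller m1 m2 k1 k2 V nc1 nc2 lc1 lc2 lc1 lc2)
           (X : 'M[R]_(n + (nc1 + nc2))) (P : 'M[R]_(l + (lc1 + lc2))),
      [/\ [/\ posdef X, full_multiplier K P & analysis_lmi gamma G K X P],
          affine_on V (csched K),
          (nc1 + nc2 <= 2 * n)%N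
        & (lc1 + lc2 <= 2 * l)%N])).
Proof.
move=> V n l.
split; last first.
  by move=> [Y [Z [U [lmi X_pos HZ]]]]; exact: (sufficiency V0 lmi X_pos HZ).
split=> [[nc1 [nc2 [lc1 [lc2 [K [X [P [X_pos P_mul lmi]]]]]]]]|].
  exact: (necessity V0 X_pos P_mul lmi).
move=> [Y [Z [U [lmi X_pos HZ]]]].
have [nc1 [nc2 [lc1 [lc2 [K [X [P [KXP _ _ _]]]]]]]] := sufficiency V0 lmi X_pos HZ.
by exists nc1, nc2, lc1, lc2, K, X, P.
Qed.
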